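(* Suppose that the error estimator satisfies stability on non-refined element domains, reduction on refined element domains, reliability, and discrete reliability, and that $b(\cdot,\cdot)$ is definite on $\mathcal X_\infty$ (all as defined in the context), and let $0<\theta\le1$. Then there exist constants $0<q_{\rm lin}<1$ and $C_{\rm lin}>0$ such that the output of the adaptive algorithm satisfies $$\eta_{\ell+n}\le C_{\rm lin}\,q_{\rm lin}^n\,\eta_\ell\quad\text{for all }\ell,n\in\mathbb N_0\text{ with }\ell\ge\ell_3,$$ where $\ell_3\in\mathbb N_0$ is an index such that, for a suitable $0<\varepsilon<1$, the quasi-orthogonality $$\|u-U_{\ell+1}\|_a^2+\|U_{\ell+1}-U_\ell\|_a^2\le\frac1{1-\varepsilon}\,\|u-U_\ell\|_a^2$$ holds for all $\ell\ge\ell_3$. (That is: there exist $\varepsilon\in(0,1)$, such an index $\ell_3$ for this $\varepsilon$, and constants $q_{\rm lin}$, $C_{\rm lin}$ with the stated property.)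
   Context: Problem. Let $\mathbb K\in\{\mathbb R,\mathbb C\}$ and let $\mathcal H$ be a separable Hilbert space over $\mathbb K$ with norm $\|\cdot\|_{\mathcal H}$, dual space $\mathcal H^*$ and duality pairing $\langle\cdot,\cdot\rangle$ on $\mathcal H^*\times\mathcal H$ (antilinear in the second argument if $\mathbb K=\mathbb C$). Let $a(\cdot,\cdot)$ be a hermitian, continuous sesquilinear form on $\mathcal H$ that is elliptic: there is $\alpha>0$ with $\alpha\|v\|_{\mathcal H}^2\le a(v,v)$ for all $v\in\mathcal H$; write $\|v\|_a:=a(v,v)^{1/2}$. Let $\mathcal K:\mathcal H\to\mathcal H^*$ be a compact linear operator, $f\in\mathcal H^*$, and $b(w,v):=a(w,v)+\langle\mathcal Kw,v\rangle$. The problem $b(u,v)=\langle f,v\rangle$ for all $v\in\mathcal H$ is assumed to be well-posed, i.e., for $w\in\mathcal H$: $w=0$ if and only if $b(w,v)=0$ for all $v\in\mathcal H$; $u\in\mathcal H$ denotes its unique solution. For a finite-dimensional subspace $\mathcal X_\bullet\subset\mathcal H$, the discrete problem is: find $U_\bullet\in\mathcal X_\bullet$ with $b(U_\bullet,V_\bullet)=\langle f,V_\bullet\rangle$ for all $V_\bullet\in\mathcal X_\bullet$. It may fail to have a unique solution; ''$U_\bullet$ exists'' means that a unique solution exists. The inf-sup constant of $\mathcal X_\bullet$ is $\gamma_\bullet:=\inf_{W\in\mathcal X_\bullet\setminus\{0\}}\sup_{V\in\mathcal X_\bullet\setminus\{0\}}\frac{|b(W,V)|}{\|W\|_{\mathcal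 H}\|V\|_{\mathcal H}}$. Meshes. $\Omega\subset\mathbb R^d$ ($d\ge2$) is a polygonal/polyhedral Lipschitz domain; $\mathcal T_0$ is a given conforming initial triangulation; the local mesh-size of $\mathcal T_\bullet$ is $h_\bullet|_T:=|T|^{1/d}$. A fixed refinement strategy (e.g. newest vertex bisection) is given: for a conforming triangulation $\mathcal T_\star$ and $\mathcal M_\star\subseteq\mathcal T_\star$, $\mathcal T_\bullet={\rm refine}(\mathcal T_\star,\mathcal M_\star)$ is the coarsest (minimal number of elements) conforming triangulation such that every $T\in\mathcal T_\star$ is the union of the elements of $\mathcal T_\bullet$ contained in it and $\mathcal M_\star\subseteq\mathcal T_\star\setminus\mathcal T_\bullet$. $\mathcal T_\bullet\in{\rm refine}(\mathcal T_\star)$ means $\mathcal T_\bullet$ is obtained from $\mathcal T_\star$ by finitely many (possibly zero) such steps, and $\mathbb T:={\rm refine}(\mathcal T_0)$. There is $0<q_{\rm mesh}<1$ such that $\mathcal T_\bullet\in{\rm refine}(\mathcal T_\star)$ implies $h_\bullet|_T\le q_{\rm mesh}h_\star|_T$ for all $T\in\mathcal T_\star\setminus\mathcal T_\bullet$. Each $\mathcal T_\star\in\mathbb T$ has an associated finite-dimensional subspace $\mathcal X_\star\subset\mathcal H$, and $\mathcal T_\bullet\in{\rm refine}(\mathcal T_\star)$ implies $\mathcal X_\star\subseteq\mathcal X_\bullet$. Uniform refinement means marking all elements; for every sequence $\widehat{\mathcal T}_0=\mathcal T_0$, $\widehat{\mathcal T}_{\ell+1}={\rm refine}(\widehat{\mathcal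 T}_\ell,\widehat{\mathcal M}_\ell)$ with $\widehat{\mathcal M}_\ell=\widehat{\mathcal T}_\ell$ for infinitely many $\ell$, $\bigcup_\ell\widehat{\mathcal X}_\ell$ is dense in $\mathcal H$. Estimator. Whenever $\mathcal T_\star\in\mathbb T$ and $U_\star$ exists, refinement indicators $\eta_\star(T)\ge0$, $T\in\mathcal T_\star$, are given; $\eta_\star(\mathcal U):=(\sum_{T\in\mathcal U}\eta_\star(T)^2)^{1/2}$ for $\mathcal U\subseteq\mathcal T_\star$ and $\eta_\star:=\eta_\star(\mathcal T_\star)$. Adaptive algorithm. Input: $0<\theta\le1$, $C_{\rm mark}\ge1$, $\mathcal T_0$, $U_{-1}:=0$, $\eta_{-1}:=1$. For $\ell=0,1,2,\dots$: if the discrete problem has no unique solution in $\mathcal X_\ell$, set $U_\ell:=U_{\ell-1}$, $\eta_\ell:=\eta_{\ell-1}$, $\mathcal T_{\ell+1}:={\rm refine}(\mathcal T_\ell,\mathcal T_\ell)$ and go to the next $\ell$. Otherwise compute the unique solution $U_\ell\in\mathcal X_\ell$ and the indicators $\eta_\ell(T)$, determine $\mathcal M_\ell\subseteq\mathcal T_\ell$ of (up to the multiplicative constant $C_{\rm mark}$) minimal cardinality such that $\theta\eta_\ell^2\le\eta_\ell(\mathcal M_\ell)^2$ (Dörfler marking), and set $\mathcal T_{\ell+1}:={\rm refine}(\mathcal T_\ell,\mathcal M_\ell)$. The output is the sequences $\mathcal T_\ell,U_\ell,\eta_\ell$; $\mathcal X_\infty:=\overline{\bigcup_{\ell\ge0}\mathcal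 X_\ell}$. Assumptions named in the claim. Stability: there is $C_{\rm stb}>0$ such that for all $\mathcal T_\star\in\mathbb T$, $\mathcal T_\bullet\in{\rm refine}(\mathcal T_\star)$ for which $U_\star,U_\bullet$ exist, $|\eta_\bullet(\mathcal T_\bullet\cap\mathcal T_\star)-\eta_\star(\mathcal T_\bullet\cap\mathcal T_\star)|\le C_{\rm stb}\|U_\bullet-U_\star\|_{\mathcal H}$. Reduction: there are $C_{\rm red}>0$, $0<q_{\rm red}<1$ such that for all such $\mathcal T_\star,\mathcal T_\bullet$, $\eta_\bullet(\mathcal T_\bullet\setminus\mathcal T_\star)^2\le q_{\rm red}\eta_\star(\mathcal T_\star\setminus\mathcal T_\bullet)^2+C_{\rm red}^2\|U_\bullet-U_\star\|_{\mathcal H}^2$. Reliability: there is $C_{\rm rel}'>0$ such that $\|u-U_\star\|_{\mathcal H}\le C_{\rm rel}'\eta_\star$ for all $\mathcal T_\star\in\mathbb T$ for which $U_\star$ exists. Discrete reliability: there is $C_{\rm rel}>0$ such that for all $\mathcal T_\star\in\mathbb T$ and $\mathcal T_\bullet\in{\rm refine}(\mathcal T_\star)$ there is a set $\mathcal R_{\star,\bullet}\subseteq\mathcal T_\star$ such that, if $U_\star,U_\bullet$ exist, $\|U_\bullet-U_\star\|_{\mathcal H}\le C_{\rm rel}\gamma_\bullet^{-1}\eta_\star(\mathcal R_{\star,\bullet})$, $\mathcal T_\star\setminus\mathcal T_\bullet\subseteq\mathcal R_{\star,\bullet}$ and $\#\mathcal R_{\star,\bullet}\le C_{\rm rel}\#(\mathcal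 T_\star\setminus\mathcal T_\bullet)$. Definiteness on $\mathcal X_\infty$: if $w\in\mathcal X_\infty$ and $b(w,v)=0$ for all $v\in\mathcal X_\infty$, then $w=0$. *)

(* Defs.v *)
From HB Require Import structures.
From mathcomp Require Import all_boot all_order all_algebra finmap.
From mathcomp Require Import complex.
From mathcomp Require Import all_classical all_reals all_analysis.
Import Order.TTheory GRing.Theory Num.Theory.
Import numFieldNormedType.Exports.

Set Implicit Arguments.
Unset Strict Implicit.
Unset Printing Implicit Defensive.

Local Open Scope classical_set_scope.
Local Open Scope ring_scope.

(** * Scalars and Hilbert spaces *)

Variant scalar_kind := RealScalars | ComplexScalars.

Definition scalars (R : realType) (k : scalar_kind) : numFieldType :=
  match k with RealScalars => R | ComplexScalars => R[i] end.

Definition sconj (R : realType) (k : scalar_kind) :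
    {rmorphism scalars R k -> scalars R k} :=
  match k with
  | RealScalars => idfun
  | ComplexScalars => @conjc R
  end.

Definition sre (R : realType) (k : scalar_kind) : scalars R k -> R :=
  match k with
  | RealScalars => id
  | ComplexScalars => @complex.Re R
  end.
Arguments sconj {R k}.
Arguments sre {R k}.

(* Library norms over [K] take values in [K]; this is the norm as a real. *)
Definition rnorm (R : realType) (k : scalar_kind)
    (V : normedModType (scalars R k)) (x : V) : R := sre `|x|.

Section Hilbert.
Context {R : realType} {k : scalar_kind} {H : completeNormedModType (scalars R k)}.
Local Notation K := (scalars R k).

Definition induces_norm (ip : {dot H for sconj}) : Prop :=
  forall x : H, `|x| ^+ 2 = ip x x.

Definition separable : Prop := exists A : set H, countable A /\ dense A.

(* The pairing of the dual with [H] being antilinear in its second argument,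
   the dual consists of the continuous antilinear functionals. *)
Definition dual_space : set (H -> K^o) :=
  [set phi | GRing.linear_for (sconj \; *%R) phi /\ continuous phi].

Definition dual_norm (phi : H -> K^o) : R :=
  sup [set rnorm (phi v) | v in [set v | rnorm v <= 1]].

Definition compact_operator (Kop : {linear H -> (H -> K^o)}) : Prop :=
  (forall w, dual_space (Kop w)) /\
  forall w : nat -> H, bounded_set (range w) ->
    exists s : nat -> nat, exists phi : H -> K^o,
      [/\ forall n, (s n < s n.+1)%N, dual_space phi &
          (fun n => dual_norm (Kop (w (s n)) - phi)) @ \oo --> (0 : R)].

Definition elliptic (a : H -> H -> K) : Prop :=
  exists2 alpha : R, 0 < alpha & forall v, alpha * rnorm v ^+ 2 <= sre (a v v).

Definition energy_norm (a : H -> H -> K) (v : H) : R := Num.sqrt (sre (a v v)).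

Definition perturbed_form (a : H -> H -> K) (Kop : H -> (H -> K^o)) (w v : H) : K :=
  a w v + Kop w v.

Definition finite_dim_subspace (X : set H) : Prop :=
  exists n (e : 'I_n -> H), X = range (fun c : 'I_n -> K => \sum_i c i *: e i).

Definition galerkin (b : H -> H -> K) (f : H -> K^o) (X : set H) (U : H) : Prop :=
  X U /\ forall V, X V -> b U V = f V.

Definition definite_on (b : H -> H -> K) (X : set H) : Prop :=
  forall w, X w -> (forall v, X v -> b w v = 0) -> w = 0.

(* For [X = {0}] the infimum is over the empty set and evaluates to [0] instead
   of [+oo]; as [0^-1 = 0], the value of [(infsup b X)^-1] is [0] either way. *)
Definition infsup (b : H -> H -> K) (X : set H) : R :=
  inf [set sup [set rnorm (b W V : K^o) / (rnorm W * rnorm V)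
               | V in X `\ (0 : H)]
      | W in X `\ (0 : H)].

End Hilbert.
Arguments separable {R k} H.

(** * Triangulations *)

(* A simplex is encoded by the finite set of its vertices and stands for their
   convex hull; a mesh is a finite set of simplices. *)
Definition simplex (R : realType) (d : nat) := {fset 'rV[R]_d}.
Definition mesh (R : realType) (d : nat) := {fset simplex R d}.

Section Triangulations.
Context {R : realType} {d : nat}.
Implicit Types (S : {fset 'rV[R]_d}) (T M : mesh R d) (Omega : set 'rV[R]_d).

Definition hull S : set 'rV[R]_d :=
  [set x | exists c : 'rV[R]_d -> R,
     [/\ forall p, 0 <= c p, \sum_(p <- S) c p = 1 &
         x = \sum_(p <- S) c p *: p]].

Definition is_simplex S : Prop :=
  #|` S| = d.+1 /\
  forall c : 'rV[R]_d -> R, \sum_(p <- S) c p = 0 ->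
    \sum_(p <- S) c p *: p = 0 -> forall p, p \in S -> c p = 0.

(* Near each boundary point, [Omega] is the region above the graph of a
   Lipschitz function over the hyperplane orthogonal to the unit vector [e];
   such a function is encoded as a function on the whole space that is constant
   in the direction [e]. *)
Definition lipschitz_domain Omega : Prop :=
  [/\ Omega !=set0, open Omega, connected Omega, bounded_set Omega &
      forall x, closure Omega x -> ~ Omega x ->
        exists r : R, exists e : 'rV[R]_d, exists phi : 'rV[R]_d -> R^o,
          [/\ 0 < r, (e *m e^T) 0 0 = 1, lipschitz phi,
              (forall y t, phi (y + t *: e) = phi y) &
              forall y, ball x r y -> (Omega y <-> phi y < (y *m e^T) 0 0)]].

Definition polyhedral Omega : Prop :=
  exists P : {fset {fset 'rV[R]_d}}, closure Omega = \bigcup_(S in [set` P]) hull S.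

Definition conforming Omega T : Prop :=
  [/\ forall S, S \in T -> is_simplex S,
      closure Omega = \bigcup_(S in [set` T]) hull S &
      forall S S', S \in T -> S' \in T -> hull S `&` hull S' = hull (S `&` S')%fset].

(* Lebesgue outer measure on [R^d]. *)
Definition volume (A : set 'rV[R]_d) : \bar R :=
  ereal_inf
    [set (\sum_(0 <= j <oo) (\prod_(i < d) (ab.2 j 0 i - ab.1 j 0 i))%:E)%E
    | ab in [set ab : (nat -> 'rV[R]_d) * (nat -> 'rV[R]_d) |
        (forall j i, ab.1 j 0 i <= ab.2 j 0 i) /\
        A `<=` \bigcup_j [set x | forall i, ab.1 j 0 i <= x 0 i <= ab.2 j 0 i]]].

Definition meshsize S : R := fine (volume (hull S)) `^ (d%:R^-1).

Definition subdivides (Ts Tb : mesh R d) : Prop :=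
  forall S, S \in Ts ->
    hull S = \bigcup_(S' in [set S' | S' \in Tb /\ hull S' `<=` hull S]) hull S'.

(* The strategy specifies through [adm Ts Tb] which subdivisions [Tb] of [Ts] it
   can produce (e.g. those generated by bisections along prescribed edges);
   [refine Ts M] is coarsest among the admissible conforming ones that refine
   all marked elements. *)
Definition refinement_strategy Omega (adm : mesh R d -> mesh R d -> Prop)
    (refine : mesh R d -> mesh R d -> mesh R d) : Prop :=
  forall Ts M, conforming Omega Ts -> (M `<=` Ts)%fset ->
    let candidate Tb :=
      [/\ adm Ts Tb, conforming Omega Tb, subdivides Ts Tb &
          (M `<=` Ts `\` Tb)%fset] in
    candidate (refine Ts M) /\
    forall Tb, candidate Tb -> (#|` refine Ts M| <= #|` Tb|)%N.

Inductive refinement (refine : mesh R d -> mesh R d -> mesh R d) (Ts : mesh R d) :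
    mesh R d -> Prop :=
| refinement0 : refinement refine Ts Ts
| refinementS T M : refinement refine Ts T -> (M `<=` T)%fset ->
    refinement refine Ts (refine T M).

Definition meshsize_reduction (refine : mesh R d -> mesh R d -> mesh R d)
    (T0 : mesh R d) : Prop :=
  exists2 q : R, 0 < q < 1 &
    forall Ts Tb, refinement refine T0 Ts -> refinement refine Ts Tb ->
    forall S, S \in (Ts `\` Tb)%fset ->
    forall S', S' \in Tb -> hull S' `<=` hull S -> meshsize S' <= q * meshsize S.

End Triangulations.

(** * Discrete spaces, error estimator and adaptive algorithm *)

Section Adaptivity.
Context {R : realType} {k : scalar_kind} {H : completeNormedModType (scalars R k)}.
Context {d : nat}.
Local Notation K := (scalars R k).
Variables (b : H -> H -> K) (f : H -> K^o).
Variables (T0 : mesh R d) (refine : mesh R d -> mesh R d -> mesh R d).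
Variable X : mesh R d -> set H.
(* [eta T S] is the indicator of the element [S] of the mesh [T]. *)
Variable eta : mesh R d -> simplex R d -> R.
Implicit Types (T M : mesh R d) (U : H).

Definition discrete_spaces : Prop :=
  (forall Ts, refinement refine T0 Ts -> finite_dim_subspace (X Ts)) /\
  (forall Ts Tb, refinement refine T0 Ts -> refinement refine Ts Tb ->
     X Ts `<=` X Tb).

Definition dense_under_uniform_refinement : Prop :=
  forall T M : nat -> mesh R d, T 0%N = T0 ->
    (forall l, (M l `<=` T l)%fset) ->
    (forall l, T l.+1 = refine (T l) (M l)) ->
    (forall N : nat, exists2 l, (N <= l)%N & M l = T l) ->
    dense (\bigcup_l X (T l)).

(* "[U] is the unique Galerkin solution on [T]"; the Galerkin solution on [T]
   exists (in the sense of unique existence) iff some [U] satisfies this. *)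
Definition is_solution T : H -> Prop := unique (galerkin b f (X T)).

Definition solution_exists T : Prop := exists U, is_solution T U.

Definition estimator T M : R := Num.sqrt (\sum_(S <- M) eta T S ^+ 2).

Definition nonneg_indicators : Prop :=
  forall Ts, refinement refine T0 Ts -> solution_exists Ts ->
  forall S, S \in Ts -> 0 <= eta Ts S.

Definition stability : Prop :=
  exists2 C : R, 0 < C &
    forall Ts Tb Us Ub, refinement refine T0 Ts -> refinement refine Ts Tb ->
    is_solution Ts Us -> is_solution Tb Ub ->
    `| estimator Tb (Tb `&` Ts)%fset - estimator Ts (Tb `&` Ts)%fset |
      <= C * rnorm (Ub - Us).

Definition reduction : Prop :=
  exists C q : R, [/\ 0 < C, 0 < q < 1 &
    forall Ts Tb Us Ub, refinement refine T0 Ts -> refinement refine Ts Tb ->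
    is_solution Ts Us -> is_solution Tb Ub ->
    estimator Tb (Tb `\` Ts)%fset ^+ 2
      <= q * estimator Ts (Ts `\` Tb)%fset ^+ 2 + C ^+ 2 * rnorm (Ub - Us) ^+ 2].

Definition reliability (u : H) : Prop :=
  exists2 C : R, 0 < C &
    forall Ts Us, refinement refine T0 Ts -> is_solution Ts Us ->
    rnorm (u - Us) <= C * estimator Ts Ts.

Definition discrete_reliability : Prop :=
  exists2 C : R, 0 < C &
    forall Ts Tb, refinement refine T0 Ts -> refinement refine Ts Tb ->
    exists2 Rset : mesh R d, (Rset `<=` Ts)%fset &
      forall Us Ub, is_solution Ts Us -> is_solution Tb Ub ->
      [/\ rnorm (Ub - Us) <= C * (infsup b (X Tb))^-1 * estimator Ts Rset,
          (Ts `\` Tb `<=` Rset)%fset &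
          #|` Rset|%:R <= C * #|` (Ts `\` Tb)%fset|%:R].

Definition doerfler (theta : R) T M : Prop :=
  (M `<=` T)%fset /\ theta * estimator T T ^+ 2 <= estimator T M ^+ 2.

Definition marking (theta Cmark : R) T M : Prop :=
  doerfler theta T M /\
  forall M', doerfler theta T M' -> #|` M|%:R <= Cmark * #|` M'|%:R.

Definition adaptive_output (theta Cmark : R)
    (T : nat -> mesh R d) (U : nat -> H) (etas : nat -> R) : Prop :=
  T 0%N = T0 /\
  forall l : nat,
    let Uprev := if l is l'.+1 then U l' else 0 in
    let etaprev := if l is l'.+1 then etas l' else 1 in
    (~ solution_exists (T l) ->
       [/\ U l = Uprev, etas l = etaprev & T l.+1 = refine (T l) (T l)]) /\
    (solution_exists (T l) ->
       exists2 M, marking theta Cmark (T l) M &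
         [/\ is_solution (T l) (U l), etas l = estimator (T l) (T l) &
             T l.+1 = refine (T l) M]).

End Adaptivity.

(* Main.v *)
Require Import Defs.
From HB Require Import structures.
From mathcomp Require Import all_boot all_order all_algebra finmap.
From mathcomp Require Import complex.
From mathcomp Require Import all_classical all_reals all_analysis.
From mathcomp Require Import ring lra.
Import Order.TTheory GRing.Theory Num.Theory.
Import numFieldNormedType.Exports.

Set Implicit Arguments.
Unset Strict Implicit.
Unset Printing Implicit Defensive.

Local Open Scope classical_set_scope.
Local Open Scope ring_scope.

(** Fix the nested spaces [V l = X (T l)] and their limit space [Xinf], the
    closure of their union. The argument has three parts.

    Stability of the discrete problems. Compactness of the perturbation makes
    bounded sequences of approximate discrete solutions strongly precompact
    ([discrete_solutions_precompact]): along a subsequence the compact term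
    converges in the dual norm, so these functions are asymptotically Galerkin
    approximations, for the elliptic form alone, of one fixed functional, and
    such approximations converge ([galerkin_riesz]). Together with definiteness
    on [Xinf] this gives a uniform discrete inf-sup constant on all sufficiently
    fine spaces ([eventual_discrete_infsup]), hence unique solvability and
    convergence of [U l] to some element of [Xinf]
    ([discrete_solutions_converge]).

    Quasi-orthogonality. The increments of [U] tend to zero, so the estimator
    reduction ([doerfler_estimator_reduction]) forces the estimator to zero, and
    by reliability the limit of [U] is [u]; in particular [u] lies in [Xinf].
    Galerkin orthogonality makes the normalized errors converge weakly to zero,
    so the compact operator maps them to a null sequence in the dual of [Xinf]
    ([compact_part_of_error_small]). In the Pythagoras identity for the energy
    norm the cross term equals this compact term, and it can be absorbed at the
    price of a factor arbitrarily close to one ([quasi_pythagoras]).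

    Contraction. Squared energy error plus a suitable multiple of the squared
    estimator contracts from step to step ([combined_contraction]); by
    reliability this sum is equivalent to the squared estimator, which therefore
    decays linearly. The contraction needs the factor of the quasi-orthogonality
    below a threshold fixed by reliability and reduction, and this determines
    [eps]. *)

(** * Scalars and the real-valued norm *)

Section RealScalarEmbedding.
Context {R : realType} {k : scalar_kind}.
Local Notation K := (scalars R k).

Definition rscalar : {rmorphism R -> K} :=
  match k return {rmorphism R -> scalars R k} with
  | RealScalars => idfun
  | ComplexScalars => real_complex R
  end.

Lemma sre_rscalar (x : R) : sre (rscalar x) = x.
Proof. by rewrite /sre /rscalar; case: k. Qed.

Lemma sre0 : sre (0 : K) = 0.
Proof. by rewrite -(rmorph0 rscalar) sre_rscalar. Qed.

Lemma sreD (x y : K) : sre (x + y) = sre x + sre y.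
Proof. by move: x y; rewrite /sre; case: k => //= -[? ?] [? ?]. Qed.

Lemma sreN (x : K) : sre (- x) = - sre x.
Proof. by move: x; rewrite /sre; case: k => //= -[? ?]. Qed.

Lemma sre_conj (x : K) : sre (sconj x) = sre x.
Proof. by move: x; rewrite /sre /sconj; case: k => //= -[? ?]. Qed.

Lemma sconjK (x : K) : sconj (sconj x) = x.
Proof. by move: x; rewrite /sconj; case: k => //= x; rewrite conjcK. Qed.

Lemma sconj_rscalar (x : R) : sconj (rscalar x) = rscalar x.
Proof. by rewrite /sconj /rscalar; case: k => //=; rewrite oppr0. Qed.

Lemma ler_rscalar (x y : R) : (rscalar x <= rscalar y) = (x <= y).
Proof. by rewrite /rscalar; case: k => //=; rewrite lecR. Qed.

Lemma normr_rscalar (x : R) : `|rscalar x| = rscalar `|x|.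
Proof.
rewrite /rscalar; case: k => //=.
by rewrite normc_def /= expr0n addr0 sqrtr_sqr.
Qed.

Lemma rscalar_sre_norm (V : normedModType K) (v : V) :
  rscalar (rnorm v) = `|v|.
Proof.
have : 0 <= `|v| by [].
rewrite /rnorm; move: `|v| => {v V}; rewrite /rscalar /sre.
by case: k => //= z z0; rewrite RRe_real // ger0_real.
Qed.

Lemma sre_le_norm (z : K) : sre z <= rnorm (z : K^o).
Proof.
rewrite /rnorm /=; move: z; rewrite /sre; case: k => /= z.
  exact: ler_norm.
case: z => x y /=; apply: le_trans (ler_norm _) _.
by rewrite -sqrtr_sqr ler_wsqrtr// lerDl sqr_ge0.
Qed.

Lemma rnorm_conj (z : K) : rnorm (sconj z : K^o) = rnorm (z : K^o).
Proof.
rewrite /rnorm /=; move: z; rewrite /sre /sconj; case: k => //= -[x y].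
by rewrite /Normc.normc /= sqrrN.
Qed.

End RealScalarEmbedding.
Arguments rscalar {R k}.

Section RealNorm.
Context {R : realType} {k : scalar_kind}.
Local Notation K := (scalars R k).
Context {V : normedModType K}.
Implicit Types (v w : V) (c : K).

Lemma rnorm_ge0 v : 0 <= rnorm v.
Proof. by rewrite -(ler_rscalar (k := k)) rmorph0 rscalar_sre_norm. Qed.

Lemma rnorm_eq0 v : (rnorm v == 0) = (v == 0).
Proof.
by rewrite -(fmorph_eq0 (rscalar (k := k))) rscalar_sre_norm normr_eq0.
Qed.

Lemma rnorm0 : rnorm (0 : V) = 0.
Proof. by apply/eqP; rewrite rnorm_eq0. Qed.

Lemma rnorm_gt0 v : (0 < rnorm v) = (v != 0).
Proof. by rewrite lt_neqAle rnorm_ge0 andbT eq_sym rnorm_eq0. Qed.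

Lemma rnormN v : rnorm (- v) = rnorm v.
Proof. by rewrite /rnorm normrN. Qed.

Lemma rnorm_distC v w : rnorm (v - w) = rnorm (w - v).
Proof. by rewrite -rnormN opprB. Qed.

Lemma rnormD v w : rnorm (v + w) <= rnorm v + rnorm w.
Proof.
by rewrite -(ler_rscalar (k := k)) rmorphD /= !rscalar_sre_norm ler_normD.
Qed.

Lemma rnormB v w : rnorm (v - w) <= rnorm v + rnorm w.
Proof. by rewrite -(rnormN w) rnormD. Qed.

Lemma rnormZ c v : rnorm (c *: v) = rnorm (c : K^o) * rnorm v.
Proof.
apply: (fmorph_inj (rscalar (k := k))).
by rewrite rmorphM /= !rscalar_sre_norm normrZ.
Qed.

Lemma rnorm_rscalar (x : R) : rnorm (rscalar x : K^o) = `|x|.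
Proof. by rewrite /rnorm /= normr_rscalar sre_rscalar. Qed.

Lemma rnormZr (x : R) v : rnorm (rscalar x *: v) = `|x| * rnorm v.
Proof. by rewrite rnormZ rnorm_rscalar. Qed.

Lemma rnorm_normalize v : v != 0 -> rnorm (rscalar (rnorm v)^-1 *: v) = 1.
Proof.
move=> v0; rewrite rnormZr ger0_norm ?invr_ge0 ?rnorm_ge0 //.
by rewrite mulVf // rnorm_eq0.
Qed.

(** The norm takes its values in the scalar field; this and the next lemma
    translate its topology to [rnorm], so that all estimates take place in the
    reals. *)
Lemma nbhs_rnormP (v : V) (A : set V) :
  nbhs v A <-> exists2 e : R, 0 < e & forall w, rnorm (v - w) < e -> A w.
Proof.
rewrite -nbhs_ballE; split.
  case=> e /= e0 eA.
  have re : rscalar (sre e) = e.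
    move: e e0 {eA}; rewrite /sre /rscalar; case: k => //= e e0.
    by rewrite RRe_real // gtr0_real.
  exists (sre e).
    have : ~~ (rscalar (sre e) <= 0 :> K) by rewrite re lt_geF.
    by rewrite -(rmorph0 (rscalar (k:=k))) ler_rscalar ltNge.
  move=> w vw; apply: eA; rewrite -ball_normE /=.
  rewrite lt_neqAle; apply/andP; split; last first.
    by rewrite -re -rscalar_sre_norm ler_rscalar ltW.
  apply/eqP => E; move: vw; rewrite /rnorm E; by rewrite ltxx.
case=> e e0 eA; exists (rscalar e) => /=.
  by rewrite lt_neqAle eq_sym fmorph_eq0 gt_eqF //= -(rmorph0 rscalar) ler_rscalar ltW.
move=> w; rewrite -ball_normE /= => vw; apply: eA.
rewrite ltNge -(ler_rscalar (k:=k)) rscalar_sre_norm.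
by apply/negP => /(lt_le_trans vw); rewrite ltxx.
Qed.

Lemma closure_rnormP (A : set V) v :
  closure A v <-> forall e : R, 0 < e -> exists2 w, A w & rnorm (v - w) < e.
Proof.
split.
  move=> cl e e0; have [|w [Aw vw]] := cl [set w | rnorm (v - w) < e].
    by apply/nbhs_rnormP; exists e.
  by exists w.
move=> h B /nbhs_rnormP [e e0 eB]; have [w Aw vw] := h e e0.
by exists w; split=> //; apply: eB.
Qed.

End RealNorm.

Section RealNormScalars.
Context {R : realType} {k : scalar_kind}.
Local Notation K := (scalars R k).

Lemma rnormM (z z' : K) : rnorm (z * z' : K^o) = rnorm (z : K^o) * rnorm (z' : K^o).
Proof. exact: (rnormZ z (z' : K^o)). Qed.

Lemma rnormMr (x : R) (z : K) : rnorm (rscalar x * z : K^o) = `|x| * rnorm (z : K^o).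
Proof. by rewrite rnormM rnorm_rscalar. Qed.

End RealNormScalars.

Section RealNormComplete.
Context {R : realType} {k : scalar_kind}.
Local Notation K := (scalars R k).
Context {H : completeNormedModType K}.

Lemma rnorm_complete (x : nat -> H) :
  (forall e : R, 0 < e -> exists N, forall m n, (N <= m)%N -> (m <= n)%N ->
     rnorm (x n - x m) < e) ->
  exists y, forall e : R, 0 < e -> exists N, forall n, (N <= n)%N ->
     rnorm (x n - y) < e.
Proof.
move=> cau.
have : cauchy (x @ \oo).
  apply/cauchy_ballP => e e0.
  have /nbhs_rnormP [r r0 rA] : nbhs (0 : H) (ball (0 : H) e) by apply: nbhsx_ballx.
  have [N hN] := cau r r0.
  have h m n : (N <= m)%N -> (N <= n)%N -> ball (x m) e (x n).
    move=> Nm Nn; rewrite -ball_normE /=.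
    have : ball (0 : H) e (x n - x m).
      apply: rA; rewrite sub0r rnormN.
      by case: (leqP m n) => mn; [|rewrite rnorm_distC]; apply: hN => //; exact: ltnW.
    by rewrite -ball_normE /= sub0r normrN distrC.
  pose tail := [set y | exists2 n, (N <= n)%N & y = x n].
  exists (tail, tail) => /=.
    by split; exists N => // n /= Nn; exists n.
  by move=> [y z] /= [[m Nm ->] [n Nn ->]]; apply: h.
move/cauchy_cvg => /cvg_ex [y xy]; exists y => e e0.
have /xy : nbhs y [set w | rnorm (y - w) < e] by apply/nbhs_rnormP; exists e.
by case=> N _ hN; exists N => n Nn; rewrite rnorm_distC; apply: hN.
Qed.

End RealNormComplete.

(** * Bounded antilinear functionals and compact operators *)

Section BoundedFunctionals.
Context {R : realType} {k : scalar_kind} {H : completeNormedModType (scalars R k)}.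
Local Notation K := (scalars R k).
Implicit Types (phi psi : H -> K^o) (v w : H).

Definition antilinear phi : Prop := GRing.linear_for (sconj \; *%R) phi.

Definition bounded_by (C : R) phi : Prop :=
  forall v, rnorm (phi v) <= C * rnorm v.

Lemma antilinear0 phi : antilinear phi -> phi 0 = 0.
Proof.
move=> phiL; have := phiL 1 0 0.
rewrite scaler0 addr0 /= rmorph1 mul1r => /eqP.
by rewrite -subr_eq subrr eq_sym => /eqP.
Qed.

Lemma antilinearD phi v w : antilinear phi -> phi (v + w) = phi v + phi w.
Proof. by move=> phiL; have := phiL 1 v w; rewrite scale1r /= rmorph1 mul1r. Qed.

Lemma antilinearZ phi c v : antilinear phi -> phi (c *: v) = sconj c * phi v.
Proof.
by move=> phiL; have := phiL c v 0; rewrite addr0 /= (antilinear0 phiL) addr0.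
Qed.

Lemma antilinearB phi v w : antilinear phi -> phi (v - w) = phi v - phi w.
Proof.
by move=> phiL; rewrite antilinearD // -scaleN1r antilinearZ // rmorphN1 mulN1r.
Qed.

Lemma antilinear_sub phi psi :
  antilinear phi -> antilinear psi -> antilinear (phi - psi).
Proof.
move=> phiL psiL c v w.
have E x : (phi - psi) x = phi x - psi x by [].
by rewrite !E phiL psiL /= opprD addrACA mulrBr.
Qed.

Lemma antilinearN phi : antilinear phi -> antilinear (- phi).
Proof.
move=> phiL c v w; have E x : (- phi) x = - phi x by [].
by rewrite !E phiL /= opprD mulrN.
Qed.

Lemma bounded_by_sub C D phi psi :
  bounded_by C phi -> bounded_by D psi -> bounded_by (C + D) (phi - psi).
Proof.
move=> phiC psiD v; apply: le_trans (rnormB _ _) _.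
by rewrite mulrDl lerD.
Qed.

Lemma bounded_byN C phi : bounded_by C phi -> bounded_by C (- phi).
Proof. by move=> phiC v; rewrite -[(- phi) v]/(- phi v) rnormN. Qed.

(** Continuity at the origin bounds [phi] by [1] on a ball of some radius [e];
    scaling a vector to norm [e / 2] transfers this bound to all vectors. *)
Lemma dual_space_bounded phi :
  dual_space phi -> antilinear phi /\ exists2 C : R, 0 < C & bounded_by C phi.
Proof.
case=> phiL phiC; split => //.
have : nbhs (0 : H) (phi @^-1` [set z : K^o | rnorm (phi 0 - z) < 1]).
  by apply: phiC; apply/nbhs_rnormP; exists 1.
move=> /nbhs_rnormP [e e0 eA]; exists (2 / e); first by rewrite divr_gt0.
move=> v; have [->|v0] := eqVneq v 0.
  by rewrite antilinear0 // !rnorm0 mulr0.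
have nv0 : 0 < rnorm v by rewrite rnorm_gt0.
have r0 : 0 < e / 2 / rnorm v by rewrite !divr_gt0.
have : rnorm (phi 0 - phi (rscalar (e / 2 / rnorm v) *: v)) < 1.
  apply: eA; rewrite sub0r rnormN rnormZr gtr0_norm // divfK ?gt_eqF //.
  by rewrite ltr_pdivrMr // ltr_pMr // ltr1n.
rewrite antilinear0 // sub0r rnormN antilinearZ // sconj_rscalar.
rewrite rnormMr gtr0_norm //.
rewrite mulrC -ltr_pdivlMr // => /ltW /le_trans; apply.
by rewrite le_eqVlt; apply/orP; left; apply/eqP; field; rewrite !gt_eqF.
Qed.

Lemma dual_norm_bound C phi :
  antilinear phi -> bounded_by C phi -> bounded_by (dual_norm phi) phi.
Proof.
move=> phiL phiC v; have [->|v0] := eqVneq v 0.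
  by rewrite antilinear0 // !rnorm0 mulr0.
have nv0 : 0 < rnorm v by rewrite rnorm_gt0.
rewrite -ler_pdivrMr //.
have -> : rnorm (phi v) / rnorm v = rnorm (phi (rscalar (rnorm v)^-1 *: v)).
  rewrite antilinearZ // sconj_rscalar rnormMr.
  by rewrite gtr0_norm ?invr_gt0 // mulrC.
apply: ub_le_sup.
  exists `|C| => _ [w /= w1 <-]; apply: le_trans (phiC w) _.
  apply: le_trans (_ : `|C| * rnorm w <= _).
    by rewrite ler_wpM2r ?rnorm_ge0 // ler_norm.
  by rewrite ler_piMr.
by exists (rscalar (rnorm v)^-1 *: v) => //=; rewrite rnorm_normalize.
Qed.

Lemma continuous_form_bounded (a : {hermitian_sym H for sconj}) :
  continuous (fun z : H * H => a z.1 z.2 : K^o) ->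
  exists2 C : R, 0 < C &
    forall v w, rnorm (a v w : K^o) <= C * rnorm v * rnorm w.
Proof.
move=> aC.
have : nbhs ((0 : H), (0 : H))
   ((fun z : H * H => a z.1 z.2 : K^o) @^-1` [set z : K^o | rnorm (a 0 0 - z : K^o) < 1]).
  by apply: aC; apply/nbhs_rnormP; exists 1.
case=> -[A B] /= [/nbhs_rnormP [e e0 eA] /nbhs_rnormP [e' e'0 eB]] AB.
pose d := Num.min e e' / 2.
have d0 : 0 < d by rewrite divr_gt0 // lt_min e0.
have small x : rnorm x = d -> A x /\ B x.
  have : d < Num.min e e'.
    by rewrite ltr_pdivrMr // ltr_pMr ?ltr1n // lt_min e0.
  rewrite lt_min => /andP[de de'] xd.
  by split; [apply: eA|apply: eB]; rewrite sub0r rnormN xd.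
exists (d ^-2); first by rewrite invr_gt0 exprn_gt0.
move=> v w; have [->|v0] := eqVneq v 0.
  by rewrite linear0l !rnorm0 mulr0 mul0r.
have [->|w0] := eqVneq w 0.
  by rewrite linear0r !rnorm0 mulr0.
have nv0 : 0 < rnorm v by rewrite rnorm_gt0.
have nw0 : 0 < rnorm w by rewrite rnorm_gt0.
pose t := d / rnorm v; pose s := d / rnorm w.
have t0 : 0 < t by rewrite divr_gt0.
have s0 : 0 < s by rewrite divr_gt0.
have /AB : (A `*` B) (rscalar t *: v, rscalar s *: w).
  by split; apply small; rewrite rnormZr gtr0_norm // divfK // gt_eqF.
rewrite /= linear0l sub0r rnormN linearZl_LR linearZr_LR /= sconj_rscalar => h.
have {h} := ltW h.
rewrite !rnormMr !gtr0_norm // => h.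
rewrite -(ler_pM2l s0) -(ler_pM2l t0); apply: le_trans h _.
rewrite le_eqVlt; apply/orP; left; apply/eqP; rewrite /t /s; field.
by rewrite !gt_eqF.
Qed.

Variable Kop : {linear H -> (H -> K^o)}.
Hypothesis Kop_compact : compact_operator Kop.

Lemma Kop_antilinear w : antilinear (Kop w).
Proof. by have [] := Kop_compact.1 w. Qed.

Lemma KopB w w' v : Kop (w - w') v = Kop w v - Kop w' v.
Proof. by rewrite raddfB. Qed.

Lemma KopZ c w v : Kop (c *: w) v = c * Kop w v.
Proof. by rewrite linearZ. Qed.

Lemma bounded_set_rnorm (W : nat -> H) (C : R) :
  (forall n, rnorm (W n) <= C) -> bounded_set (range W).
Proof.
move=> WC; exists (rscalar C); split.
  by apply/orP; case: (leP 0 C) => C0; [left|right];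
    rewrite -(rmorph0 rscalar) ler_rscalar // ltW.
move=> x Cx _ [n _ <-] /=; apply: le_trans (ltW Cx).
by rewrite -rscalar_sre_norm ler_rscalar.
Qed.

(** Dual-norm convergence is rendered through [bounded_by], which keeps suprema
    out of the later arguments. *)
Lemma compact_operator_subseq (W : nat -> H) (C : R) :
  (forall n, rnorm (W n) <= C) ->
  exists (s : nat -> nat) phi, [/\ forall n, (n <= s n)%N, antilinear phi,
    exists2 D : R, 0 < D & bounded_by D phi &
    forall e : R, 0 < e -> exists N, forall n, (N <= n)%N ->
      bounded_by e (Kop (W (s n)) - phi)].
Proof.
move=> /bounded_set_rnorm /(Kop_compact.2) [s [phi [sS phiD cv]]].
have [phiL [D D0 phiB]] := dual_space_bounded phiD.
exists s, phi; split => //.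
- by elim=> // n IH; apply: leq_ltn_trans IH (sS n).
- by exists D.
move=> e e0; have /cvgrPdist_lt /(_ e e0) [N _ hN] := cv.
exists N => n Nn v; have {hN} := hN n Nn; rewrite /= sub0r normrN => hN.
have [wL [C' _ wB]] := dual_space_bounded (Kop_compact.1 (W (s n))).
apply: le_trans (dual_norm_bound (antilinear_sub wL phiL) (bounded_by_sub wB phiB) v) _.
by rewrite ler_wpM2r ?rnorm_ge0 // (le_trans (ler_norm _)) // ltW.
Qed.

(** On unit vectors with unbounded images, a subsequence of the images would
    still converge in the dual norm and hence be bounded. *)
Lemma compact_operator_bounded :
  exists2 C : R, 0 < C & forall w v, rnorm (Kop w v) <= C * rnorm w * rnorm v.
Proof.
apply: contrapT => nb.
have {nb} blow (n : nat) : exists wv : H * H,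
    n.+1%:R * rnorm wv.1 * rnorm wv.2 < rnorm (Kop wv.1 wv.2).
  apply: contrapT => h; apply: nb; exists n.+1%:R => // w v.
  by rewrite leNgt; apply/negP => lt; apply: h; exists (w, v).
have [wv wvP] := choice blow.
have w0 n : (wv n).1 != 0.
  apply/eqP => E; have := wvP n; rewrite E raddf0 rnorm0 mulr0 mul0r.
  by rewrite [X in rnorm X](_ : _ = 0) // rnorm0 ltxx.
pose W n := rscalar (rnorm (wv n).1)^-1 *: (wv n).1.
have W1 n : rnorm (W n) <= 1 by rewrite rnorm_normalize.
have [s [phi [sn _ [D _ phiD] cv]]] := compact_operator_subseq W1.
have [N hN] := cv 1 ltr01.
(* From [N] on the images are bounded by [D + 1], whereas those with index
   beyond [D + 1] exceed this bound. *)
pose m := maxn N (Num.truncn (D + 1)).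
have := wvP (s m); set w := (wv (s m)).1; set v := (wv (s m)).2.
have nw0 : 0 < rnorm w by rewrite rnorm_gt0 w0.
have := hN m (leq_maxl _ _) v; rewrite [X in rnorm X]/= -/(W _) => h1.
have {h1} : rnorm (Kop (W (s m)) v) <= (D + 1) * rnorm v.
  rewrite -[X in rnorm X](subrK (phi v)); apply: le_trans (rnormD _ _) _.
  by rewrite mulrDl addrC lerD.
rewrite /W -/w KopZ rnormMr gtr0_norm ?invr_gt0 // => h1 h2.
have : (s m).+1%:R * rnorm v < (D + 1) * rnorm v.
  apply: lt_le_trans h1.
  by rewrite [ltRHS]mulrC ltr_pdivlMr // mulrAC.
have [v0|v0] := eqVneq (rnorm v) 0; first by rewrite v0 !mulr0 ltxx.
rewrite ltr_pM2r; last by rewrite lt_neqAle eq_sym v0 rnorm_ge0.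
move=> lt; suff : D + 1 <= (s m).+1%:R by rewrite leNgt lt.
apply: le_trans (ltW (truncnS_gt _)) _.
by rewrite ler_nat ltnS (leq_trans _ (sn m)) // leq_maxr.
Qed.

End BoundedFunctionals.

(** * Galerkin systems on finite-dimensional spaces *)

Section GalerkinSolvability.
Context {R : realType} {k : scalar_kind} {H : completeNormedModType (scalars R k)}.
Local Notation K := (scalars R k).
Implicit Types (b : H -> H -> K) (phi : H -> K^o) (X : set H).

Definition sesquilinear b : Prop :=
  (forall c w w' v, b (c *: w + w') v = c * b w v + b w' v) /\
  forall w, antilinear (b w).

Lemma sesquilinear0l b v : sesquilinear b -> b 0 v = 0.
Proof.
case=> bl _; have := bl 1 0 0 v; rewrite scaler0 addr0 mul1r => /eqP.
by rewrite -subr_eq subrr eq_sym => /eqP.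
Qed.

Lemma sesquilinearZl b c w v : sesquilinear b -> b (c *: w) v = c * b w v.
Proof. by move=> bS; have := bS.1 c w 0 v; rewrite sesquilinear0l // !addr0. Qed.

Lemma sesquilinearBl b w w' v : sesquilinear b -> b (w - w') v = b w v - b w' v.
Proof.
move=> bS; have := bS.1 (- 1) w' w v.
by rewrite scaleN1r mulN1r addrC => ->; rewrite addrC.
Qed.

Lemma sesquilinear_suml b n (c : 'I_n -> K) (e : 'I_n -> H) v :
  sesquilinear b -> b (\sum_i c i *: e i) v = \sum_i c i * b (e i) v.
Proof.
move=> bS; elim/big_ind2: _ => [|x1 x2 y1 y2 <- <-|i _].
- exact: sesquilinear0l.
- by have := bS.1 1 x2 y2 v; rewrite scale1r mul1r.
- exact: sesquilinearZl.
Qed.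

Lemma antilinear_sum phi n (c : 'I_n -> K) (e : 'I_n -> H) :
  antilinear phi -> phi (\sum_i c i *: e i) = \sum_i sconj (c i) * phi (e i).
Proof.
move=> phiL; elim/big_ind2: _ => [|x1 x2 y1 y2 <- <-|i _].
- exact: antilinear0.
- exact: antilinearD.
- exact: antilinearZ.
Qed.

Lemma finite_dim_linear X (c : K) v w :
  finite_dim_subspace X -> X v -> X w -> X (c *: v + w).
Proof.
case=> n [e ->] [x _ <-] [y _ <-]; exists (fun i => c * x i + y i) => //.
rewrite scaler_sumr -big_split /=; apply: eq_bigr => i _.
by rewrite scalerDl scalerA.
Qed.

Lemma finite_dim0 X : finite_dim_subspace X -> X 0.
Proof.
case=> n [e ->]; exists (fun=> 0) => //.
by rewrite big1 // => i _; rewrite scale0r.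
Qed.

Lemma finite_dimZ X (c : K) v : finite_dim_subspace X -> X v -> X (c *: v).
Proof.
by move=> fX Xv; rewrite -[_ *: _]addr0; apply: finite_dim_linear => //; apply: finite_dim0.
Qed.

Lemma finite_dimB X v w : finite_dim_subspace X -> X v -> X w -> X (v - w).
Proof.
by move=> fX Xv Xw; rewrite addrC -scaleN1r; apply: finite_dim_linear.
Qed.

(** The generators of [X] may be dependent. Definiteness says that the left
    kernel of their Gram matrix consists of linear relations among them, and
    every such relation, conjugated, annihilates both the rows of the Gram
    matrix and the right-hand side. Counting dimensions, the rows fill the
    annihilator of the relations, so the right-hand side is a combination of
    them. *)
Lemma definite_galerkin_ex b X phi :
  sesquilinear b -> finite_dim_subspace X -> antilinear phi ->
  definite_on b X -> exists U, galerkin b phi X U.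
Proof.
move=> bS [n [e ->]] phiL bdef.
pose B := \matrix_(i < n, j < n) b (e i) (e j).
pose F := \row_(j < n) phi (e j).
move: (kermx B) (mulmx_ker B) (mxrank_ker B) => N NB rankN.
have relE i : \sum_j N i j *: e j = 0.
  apply: bdef; first by exists (N i).
  move=> _ [y _ <-]; rewrite (antilinear_sum _ _ (bS.2 _)); apply: big1 => j _.
  rewrite sesquilinear_suml //.
  suff -> : \sum_l N i l * b (e l) (e j) = 0 by rewrite mulr0.
  have /matrixP/(_ i j) := NB; rewrite mxE [RHS]mxE.
  by move=> h; apply: etrans h; apply: eq_bigr => l _; rewrite mxE.
pose N' := trmx (map_mx sconj N).
have annih m (A : 'M[K]_(m, n)) (psi : 'I_m -> H -> K^o) :
    (forall i, antilinear (psi i)) -> (forall i j, A i j = psi i (e j)) ->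
    (A <= kermx N')%MS.
  move=> psiL AE; apply/sub_kermxP/matrixP => i j; rewrite mxE [RHS]mxE.
  have := antilinear0 (psiL i); rewrite -(relE j) antilinear_sum //.
  by move=> h; apply: etrans h; apply: eq_bigr => l _; rewrite AE !mxE mulrC.
have BN : (B <= kermx N')%MS.
  by apply: (annih _ _ (fun i => b (e i))) => [i|i j]; [exact: bS.2|rewrite mxE].
have FN : (F <= kermx N')%MS.
  by apply: (annih _ _ (fun=> phi)) => // i j; rewrite mxE.
have : (F <= B)%MS.
  apply: submx_trans FN _; rewrite -(mxrank_leqif_sup BN).
  by rewrite mxrank_ker mxrank_tr mxrank_map rankN subKn // rank_leq_row.
case/submxP => D FD; exists (\sum_i D 0 i *: e i); split; first by exists (D 0).
move=> _ [y _ <-]; rewrite (antilinear_sum _ _ (bS.2 _)) antilinear_sum //.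
apply: eq_bigr => j _; congr (_ * _); rewrite sesquilinear_suml //.
have /matrixP/(_ 0 j) := FD; rewrite mxE => ->; rewrite mxE.
by apply: eq_bigr => i _; rewrite mxE.
Qed.

Lemma definite_galerkin_unique b X phi U :
  sesquilinear b -> finite_dim_subspace X -> definite_on b X ->
  galerkin b phi X U -> unique (galerkin b phi X) U.
Proof.
move=> bS fX bdef [XU UE]; split=> // U' [XU' U'E].
apply/eqP; rewrite -subr_eq0; apply/eqP/bdef; first exact: finite_dimB.
by move=> v Xv; rewrite sesquilinearBl // UE // U'E // subrr.
Qed.
End GalerkinSolvability.

(** * The limit space and the Riesz representation on it *)

Section NestedSubspaces.
Context {R : realType} {k : scalar_kind} {H : completeNormedModType (scalars R k)}.
Local Notation K := (scalars R k).

Lemma rnorm_small_eq0 (V : normedModType K) (x : V) (C : R) :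
  (forall e, 0 < e -> rnorm x <= C * e) -> x = 0.
Proof.
move=> h; apply/eqP; rewrite -rnorm_eq0 eq_le rnorm_ge0 andbT.
have C1 : 0 < `|C| + 1 by rewrite ltr_wpDl.
apply/ler_addgt0Pr => e e0; rewrite add0r.
apply: le_trans (h (e / (`|C| + 1)) _) _; first by rewrite divr_gt0.
rewrite mulrA mulrAC -[leRHS]mul1r ler_wpM2r ?(ltW e0) //.
by rewrite ler_pdivrMr // mul1r (le_trans (ler_norm _)) // lerDl.
Qed.

Variable V : nat -> set H.
Hypothesis V_finite_dim : forall l, finite_dim_subspace (V l).
Hypothesis V_nested : forall l m, (l <= m)%N -> V l `<=` V m.

Local Notation Xinf := (closure (\bigcup_l V l)).

Lemma limit_spaceP x : Xinf x <->
  forall e : R, 0 < e -> exists l, exists2 v, V l v & rnorm (x - v) < e.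
Proof.
split.
  move=> /closure_rnormP h e e0; have [v [l _ Vv] xv] := h e e0.
  by exists l, v.
move=> h; apply/closure_rnormP => e e0; have [l [v Vv xv]] := h e e0.
by exists v => //; exists l.
Qed.

Lemma limit_space_sub l : V l `<=` Xinf.
Proof. by move=> v Vv; apply: subset_closure; exists l. Qed.

Lemma limit_space_cvg (x : nat -> H) y (l : nat -> nat) :
  (forall n, V (l n) (x n)) ->
  (forall e : R, 0 < e -> exists N, forall n, (N <= n)%N -> rnorm (x n - y) < e) ->
  Xinf y.
Proof.
move=> Vx xy; apply/limit_spaceP => e e0; have [N hN] := xy e e0.
by exists (l N), (x N) => //; rewrite rnorm_distC hN.
Qed.

Lemma limit_spaceB x y : Xinf x -> Xinf y -> Xinf (x - y).
Proof.
move=> /limit_spaceP Xx /limit_spaceP Xy; apply/limit_spaceP => e e0.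
have e2 : 0 < e / 2 by rewrite divr_gt0.
have [l [v Vv xv]] := Xx _ e2; have [m [w Vw yw]] := Xy _ e2.
exists (maxn l m), (v - w).
  apply: finite_dimB => //.
    by apply: V_nested Vv; exact: leq_maxl.
  by apply: V_nested Vw; exact: leq_maxr.
rewrite (_ : x - y - (v - w) = (x - v) - (y - w)); last first.
  by rewrite !opprB [w - v]addrC addrACA [- y + w]addrC.
by apply: le_lt_trans (rnormB _ _) _; rewrite [ltRHS]splitr ltrD.
Qed.

Lemma limit_spaceZ (c : K) x : Xinf x -> Xinf (c *: x).
Proof.
move=> /limit_spaceP Xx; apply/limit_spaceP => e e0.
have c1 : 0 < rnorm (c : K^o) + 1 by rewrite ltr_wpDl // rnorm_ge0.
have [|l [v Vv xv]] := Xx (e / (rnorm (c : K^o) + 1)); first by rewrite divr_gt0.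
exists l, (c *: v); first exact: finite_dimZ.
rewrite -scalerBr rnormZ; apply: le_lt_trans (_ : (rnorm (c : K^o) + 1) * rnorm (x - v) < _).
  by rewrite ler_wpM2r ?rnorm_ge0 // lerDl.
by rewrite mulrC -ltr_pdivlMr.
Qed.

(** The means of passing from identities on the discrete spaces to identities
    on the limit space. *)
Lemma antilinear_vanish_limit (psi : H -> K^o) (C : R) :
  antilinear psi -> bounded_by C psi -> (forall l v, V l v -> psi v = 0) ->
  forall v, Xinf v -> psi v = 0.
Proof.
move=> psiL psiC psi0 v /limit_spaceP Xv; apply: (@rnorm_small_eq0 _ _ `|C|) => e e0.
have [l [w Vw vw]] := Xv e e0.
rewrite -[psi v](subr0) -(psi0 l w Vw) -antilinearB //.
apply: le_trans (psiC _) _; apply: le_trans (_ : `|C| * rnorm (v - w) <= _).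
  by rewrite ler_wpM2r ?rnorm_ge0 // ler_norm.
by rewrite ler_wpM2l // ltW.
Qed.

Section HermitianForm.
Variable a : {hermitian_sym H for sconj}.
Variables alpha Ca : R.
Hypothesis alpha_gt0 : 0 < alpha.
Hypothesis a_coercive : forall v, alpha * rnorm v ^+ 2 <= sre (a v v).
Hypothesis Ca_gt0 : 0 < Ca.
Hypothesis a_bounded : forall v w, rnorm (a v w : K^o) <= Ca * rnorm v * rnorm w.

Lemma hermitian_sesquilinear : sesquilinear a.
Proof. by split=> [c w w' v|w c v v']; rewrite ?linearPl ?linearPr. Qed.

Lemma hermitian_conj v w : a v w = sconj (a w v).
Proof. by rewrite hermC expr0 mul1r. Qed.

Lemma energy_expand v w :
  sre (a (v + w) (v + w)) = sre (a v v) + sre (a w w) + 2 * sre (a v w).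
Proof.
have -> : a (v + w) (v + w) = a v v + a v w + (a w v + a w w).
  by rewrite linearDl !linearDr.
rewrite !sreD (hermitian_conj w v) sre_conj; ring.
Qed.

Lemma coercive_definite X : definite_on a X.
Proof.
move=> w Xw aw; apply/eqP; rewrite -rnorm_eq0 -sqrf_eq0 eq_le sqr_ge0 andbT.
rewrite -(pmulr_rle0 _ alpha_gt0); apply: le_trans (a_coercive w) _.
by rewrite aw // sre0.
Qed.

(** Ellipticity in the form in which it is applied: testing a residual with
    the error itself bounds the error. *)
Lemma coercive_bound x (r : R) : 0 <= r -> rnorm (a x x : K^o) <= r * rnorm x ->
  alpha * rnorm x <= r.
Proof.
move=> r0 h; have [->|x0] := eqVneq (rnorm x) 0; first by rewrite mulr0.
have {}x0 : 0 < rnorm x by rewrite lt_neqAle eq_sym x0 rnorm_ge0.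
rewrite -(ler_pM2r x0) -mulrA -expr2.
exact: le_trans (a_coercive x) (le_trans (sre_le_norm _) h).
Qed.

(** The Riesz representation theorem for the energy product on the closure of
    nested finite-dimensional spaces. The representer is the limit of the
    representers on the finite-dimensional spaces: by Pythagoras their squared
    energies increase, and they are bounded, so they form a Cauchy sequence. *)
Lemma galerkin_riesz (phi : H -> K^o) (D : R) :
  antilinear phi -> 0 <= D -> bounded_by D phi ->
  exists (G : nat -> H) (G' : H),
    [/\ forall n, galerkin a phi (V n) (G n),
        forall e : R, 0 < e -> exists N, forall n, (N <= n)%N -> rnorm (G n - G') < e,
        Xinf G' & forall v, Xinf v -> a G' v = phi v].
Proof.
move=> phiL D0 phiD.
have /choice[G GP] : forall n, exists U, galerkin a phi (V n) U.
  move=> n; apply: definite_galerkin_ex => //; first exact: hermitian_sesquilinear.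
  exact: coercive_definite.
have VG m n : (m <= n)%N -> V n (G m).
  by move=> mn; apply: V_nested mn _ _; case: (GP m).
have orth m n v : (m <= n)%N -> V m v -> a (G n - G m) v = 0.
  move=> mn Vv; rewrite linearBl /= (GP m).2 // (GP n).2 ?subrr //.
  exact: V_nested mn _ Vv.
pose s n := sre (a (G n) (G n)).
have pyth m n : (m <= n)%N -> s n = s m + sre (a (G n - G m) (G n - G m)).
  move=> mn; rewrite /s -{1 2}(subrKC (G m) (G n)) energy_expand.
  rewrite [X in 2 * sre X]hermitian_conj (orth m n (G m) mn (VG _ _ (leqnn m))).
  by rewrite sre_conj sre0 mulr0 addr0.
have aGG n : a (G n) (G n) = phi (G n) by rewrite (GP n).2 //; case: (GP n).
have Gbd n : alpha * rnorm (G n) <= D.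
  by apply: coercive_bound => //; rewrite aGG.
have s_ub n : s n <= D * (D / alpha).
  rewrite /s aGG; apply: le_trans (sre_le_norm _) _.
  apply: le_trans (phiD _) _; rewrite ler_wpM2l // ler_pdivlMr // mulrC.
  exact: Gbd.
have has_sup_s : has_sup (range s).
  split; first by exists (s 0%N), 0%N.
  by exists (D * (D / alpha)) => _ [n _ <-].
have [G' GG'] : exists y, forall e : R, 0 < e -> exists N, forall n, (N <= n)%N ->
     rnorm (G n - y) < e.
  apply: rnorm_complete => e e0.
  have ae : 0 < alpha * e ^+ 2 by rewrite mulr_gt0 // exprn_gt0.
  (* Beyond an index whose energy is this close to the supremum, energies
     differ by less than [alpha * e ^+ 2]. *)
  have [_ [N _ <-] sN] := sup_adherent ae has_sup_s.
  exists N => m n Nm mn.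
  have sNm : s N <= s m.
    rewrite (pyth N m) // lerDl; apply: le_trans (a_coercive _).
    by rewrite mulr_ge0 ?(ltW alpha_gt0) // sqr_ge0.
  have sn : s n <= sup (range s) by apply: ub_le_sup; [exact: has_sup_s.2|exists n].
  rewrite -(ltr_pXn2r (ltn0Sn 1)) ?nnegrE ?rnorm_ge0 ?(ltW e0) //.
  rewrite -(ltr_pM2l alpha_gt0); apply: le_lt_trans (a_coercive _) _.
  by move: (pyth m n mn); lra.
have aS := hermitian_sesquilinear.
exists G, G'; split=> //.
  by apply: (limit_space_cvg (x := G) (l := id)) GG' => n; apply: VG.
move=> v Xv; apply/eqP; rewrite -subr_eq0; apply/eqP.
rewrite -[a G' v - phi v]/(((a G' : H -> K^o) - phi) v).
apply: (@antilinear_vanish_limit _ (Ca * rnorm G' + D)) => //.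
- by apply: antilinear_sub => //; apply: aS.2.
- by apply: bounded_by_sub => // w; apply: a_bounded.
move=> l w Vw; apply: (@rnorm_small_eq0 _ _ (Ca * rnorm w)) => e e0.
have [N hN] := GG' e e0.
have Nl := hN (maxn N l) (leq_maxl _ _).
rewrite -[_ w]/(a G' w - phi w) -(GP (maxn N l)).2; last first.
  by apply: V_nested Vw; exact: leq_maxr.
rewrite -linearBl; apply: le_trans (a_bounded _ _) _.
by rewrite mulrAC ler_wpM2l ?mulr_ge0 ?rnorm_ge0 ?(ltW Ca_gt0) // rnorm_distC ltW.
Qed.

End HermitianForm.
End NestedSubspaces.

(** * Compactly perturbed forms *)

Section CompactPerturbation.
Context {R : realType} {k : scalar_kind} {H : completeNormedModType (scalars R k)}.
Local Notation K := (scalars R k).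

Variable V : nat -> set H.
Hypothesis V_finite_dim : forall l, finite_dim_subspace (V l).
Hypothesis V_nested : forall l m, (l <= m)%N -> V l `<=` V m.
Local Notation Xinf := (closure (\bigcup_l V l)).

Variable a : {hermitian_sym H for sconj}.
Variables alpha Ca : R.
Hypothesis alpha_gt0 : 0 < alpha.
Hypothesis a_coercive : forall v, alpha * rnorm v ^+ 2 <= sre (a v v).
Hypothesis Ca_gt0 : 0 < Ca.
Hypothesis a_bounded : forall v w, rnorm (a v w : K^o) <= Ca * rnorm v * rnorm w.

Variable Kop : {linear H -> (H -> K^o)}.
Hypothesis Kop_compact : compact_operator Kop.
Variable Ck : R.
Hypothesis Ck_gt0 : 0 < Ck.
Hypothesis Kop_bounded : forall w v, rnorm (Kop w v) <= Ck * rnorm w * rnorm v.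

Local Notation b := (perturbed_form a Kop).
Hypothesis b_definite : definite_on b Xinf.

Lemma perturbed_sesquilinear : sesquilinear b.
Proof.
have aS := hermitian_sesquilinear a.
split=> [c w w' v|w c v v']; rewrite /perturbed_form.
  rewrite aS.1 (linearP Kop) /=.
  by rewrite -[(c *: Kop w + Kop w') v]/(c * Kop w v + Kop w' v) mulrDr addrACA.
by rewrite aS.2 (Kop_antilinear Kop_compact) /= mulrDr addrACA.
Qed.

Lemma perturbed_bounded w v :
  rnorm (b w v : K^o) <= (Ca + Ck) * rnorm w * rnorm v.
Proof.
by apply: le_trans (rnormD _ _) _; rewrite !mulrDl lerD ?a_bounded ?Kop_bounded.
Qed.

(** Compactness of the perturbation makes a bounded sequence of approximate
    discrete solutions strongly precompact. Along a subsequence the images under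
    the compact operator converge to some [phi] in the dual norm; the discrete
    functions then are, up to a vanishing error, the Galerkin approximations of
    the Riesz representer of [g - phi], so they inherit its strong
    convergence. *)
Lemma discrete_solutions_precompact (W : nat -> H) (l : nat -> nat) (C : R)
    (g : H -> K^o) (Dg : R) :
  (forall n, (n <= l n)%N) -> (forall n, V (l n) (W n)) ->
  (forall n, rnorm (W n) <= C) -> antilinear g -> 0 <= Dg -> bounded_by Dg g ->
  (forall e : R, 0 < e -> exists N, forall n, (N <= n)%N ->
     forall v, V (l n) v -> rnorm (b (W n) v - g v : K^o) <= e * rnorm v) ->
  exists (s : nat -> nat) (W' : H), [/\ forall n, (n <= s n)%N,
    forall e : R, 0 < e -> exists N, forall n, (N <= n)%N -> rnorm (W (s n) - W') < e,
    Xinf W' & forall v, Xinf v -> b W' v = g v].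
Proof.
move=> nl VW WC gL Dg0 gD res.
have [s [phi [ns phiL [D D0 phiD] cvK]]] := compact_operator_subseq Kop_compact WC.
have [G [G' [GP GG' XG' G'P]]] := galerkin_riesz V_finite_dim V_nested alpha_gt0
  a_coercive Ca_gt0 a_bounded (antilinear_sub gL phiL)
  (addr_ge0 Dg0 (ltW D0)) (bounded_by_sub gD phiD).
have WG' : forall e : R, 0 < e ->
    exists N, forall n, (N <= n)%N -> rnorm (W (s n) - G') < e.
  move=> e e0; have e3 : 0 < alpha * (e / 4) by rewrite mulr_gt0 // divr_gt0.
  have [N1 hN1] := res _ e3; have [N2 hN2] := cvK _ e3.
  have [N3 hN3] := GG' (e / 2) (divr_gt0 e0 (ltr0Sn _ _)).
  exists (maxn N1 (maxn N2 N3)) => n; rewrite !geq_max => /and3P[n1 n2 n3].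
  have nls : (n <= l (s n))%N by apply: leq_trans (ns n) (nl _).
  set Gn := G (l (s n)); set x := W (s n) - Gn.
  have Vx : V (l (s n)) x by apply: finite_dimB => //; case: (GP (l (s n))).
  have axx : a x x = (b (W (s n)) x - g x) - (Kop (W (s n)) x - phi x).
    rewrite {1}/x linearBl /= (GP _).2 // /perturbed_form.
    rewrite -[(g - phi) x]/(g x - phi x).
    have alg (p q t z : K) : p - (t - z) = p + q - t - (q - z) by ring.
    exact: alg.
  have nx : alpha * rnorm x <= alpha * (e / 4) + alpha * (e / 4).
    apply: (coercive_bound a_coercive); first by rewrite addr_ge0 // ltW.
    rewrite axx; apply: le_trans (rnormB _ _) _; rewrite mulrDl lerD //.
      by apply: hN1 => //; apply: leq_trans n1 (ns n).
    exact: hN2.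
  rewrite -mulrDr ler_pM2l // in nx.
  have nG := hN3 _ (leq_trans n3 nls).
  rewrite -(subrKA Gn); apply: le_lt_trans (rnormD _ _) _.
  rewrite -/x -/Gn in nG *; move: nx nG; lra.
exists s, G'; split => // v Xv.
(* Boundedness of the operator identifies the dual-norm limit. *)
have KG' : Kop G' v = phi v.
  apply/eqP; rewrite -subr_eq0; apply/eqP.
  apply: (@rnorm_small_eq0 _ _ _ _ ((Ck + 1) * rnorm v)) => e e0.
  have [N1 hN1] := WG' e e0; have [N2 hN2] := cvK e e0.
  pose n := maxn N1 N2.
  have h1 := hN1 n (leq_maxl _ _); have h2 := hN2 n (leq_maxr _ _) v.
  rewrite -[X in rnorm X](subrKA (Kop (W (s n)) v)); apply: le_trans (rnormD _ _) _.
  rewrite -KopB mulrDl mul1r mulrDl [rnorm v * e]mulrC lerD //.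
  apply: le_trans (Kop_bounded _ _) _; rewrite mulrAC ler_wpM2l //.
    by rewrite mulr_ge0 ?rnorm_ge0 // ltW.
  by rewrite rnorm_distC ltW.
rewrite /perturbed_form G'P // KG'.
by rewrite -[(g - phi) v]/(g v - phi v) subrK.
Qed.

(** Otherwise there would be normalized discrete functions with vanishing
    residuals on arbitrarily fine spaces. Their strong limit would be a unit
    vector in the kernel of [b] on the limit space. Bounding residuals by [r]
    instead of forming the inf-sup quotient yields both definiteness ([r = 0])
    and a priori bounds; the sign of [r] matters when [V l] is trivial. *)
Lemma eventual_discrete_infsup :
  exists2 gamma : R, 0 < gamma & exists L, forall l, (L <= l)%N ->
    forall w r, V l w -> 0 <= r ->
      (forall v, V l v -> rnorm (b w v : K^o) <= r * rnorm v) ->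
      gamma * rnorm w <= r.
Proof.
apply: contrapT => nis.
have {nis} bad (n : nat) : exists lw : nat * H, [/\ (n <= lw.1)%N, V lw.1 lw.2,
    rnorm lw.2 = 1 & forall v, V lw.1 v ->
      rnorm (b lw.2 v : K^o) <= n.+1%:R^-1 * rnorm v].
  apply: contrapT => h; apply: nis; exists n.+1%:R^-1; first by rewrite invr_gt0.
  exists n => l nl w r Vw r0 wr; rewrite leNgt; apply/negP => lt.
  have w0 : w != 0.
    by apply/eqP => w0; move: lt; rewrite w0 rnorm0 mulr0 ltNge r0.
  apply: h; exists (l, rscalar (rnorm w)^-1 *: w); split=> //=.
  - exact: finite_dimZ.
  - exact: rnorm_normalize.
  - move=> v Vv; rewrite (sesquilinearZl _ _ _ perturbed_sesquilinear) rnormMr.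
    rewrite gtr0_norm ?invr_gt0 ?rnorm_gt0 // mulrC ler_pdivrMr ?rnorm_gt0 //.
    apply: le_trans (wr v Vv) _; rewrite mulrAC ler_wpM2r ?rnorm_ge0 //.
    exact: ltW.
have [lw lwP] := choice bad.
pose zero : H -> K^o := fun=> 0.
have zeroL : antilinear zero.
  by move=> c v w; rewrite /zero /= mulr0 addr0.
have zeroB : bounded_by (0 : R) zero.
  by move=> v; rewrite /zero rnorm0 mul0r.
have [||||s [W [_ cv XW bW]]] := @discrete_solutions_precompact
  (fun n => (lw n).2) (fun n => (lw n).1) 1 _ 0 _ _ _ zeroL (lexx 0) zeroB.
- by move=> n; case: (lwP n).
- by move=> n; case: (lwP n).
- by move=> n; case: (lwP n) => _ _ ->.
- move=> e e0; exists (Num.truncn e^-1) => n Nn v Vv; rewrite subr0.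
  have [_ _ _ h] := lwP n; apply: le_trans (h v Vv) _.
  rewrite ler_wpM2r ?rnorm_ge0 // invf_ple ?posrE //.
  by apply: le_trans (ltW (truncnS_gt _)) _; rewrite ler_nat.
have W0 : W = 0 by apply: b_definite.
have [N hN] := cv 1 ltr01; have := hN N (leqnn N).
by rewrite W0 subr0; case: (lwP (s N)) => _ _ -> _; rewrite ltxx.
Qed.

Variable f : H -> K^o.
Hypothesis f_antilinear : antilinear f.
Variable Df : R.
Hypothesis Df_ge0 : 0 <= Df.
Hypothesis f_bounded : bounded_by Df f.

(** Discrete inf-sup stability makes the discrete solutions exist, bounds them,
    and makes them quasi-optimal. Their limit is found by precompactness, and
    quasi-optimality upgrades the convergence to the whole sequence. *)
Lemma discrete_solutions_converge : exists L : nat,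
  (forall l, (L <= l)%N -> exists U, unique (galerkin b f (V l)) U) /\
  forall U : nat -> H, (forall l, (L <= l)%N -> galerkin b f (V l) (U l)) ->
    exists2 U' : H, Xinf U' & forall e : R, 0 < e -> exists N, forall l, (N <= l)%N ->
      rnorm (U l - U') < e.
Proof.
have [gamma g0 [L infsup_L]] := eventual_discrete_infsup.
have bS := perturbed_sesquilinear.
have bdef l : (L <= l)%N -> definite_on b (V l).
  move=> Ll w Vw bw; apply/eqP; rewrite -rnorm_eq0 eq_le rnorm_ge0 andbT.
  rewrite -(pmulr_rle0 _ g0); apply: infsup_L Ll _ _ Vw (lexx 0) _ => v Vv.
  by rewrite bw // rnorm0 mul0r.
exists L; split.
  move=> l Ll.
  have [U UP] := definite_galerkin_ex bS (V_finite_dim l) f_antilinear (bdef l Ll).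
  by exists U; apply: definite_galerkin_unique => //; apply: bdef.
move=> U UP.
have Ubd l : (L <= l)%N -> gamma * rnorm (U l) <= Df.
  move=> Ll; apply: (infsup_L l Ll) => //; first by case: (UP l Ll).
  by move=> v Vv; rewrite (UP l Ll).2.
have [||||s [U' [_ _ XU' bU']]] := @discrete_solutions_precompact
  (fun n => U (n + L)%N) (fun n => (n + L)%N) (Df / gamma) f Df _ _ _ f_antilinear Df_ge0 f_bounded.
- by move=> n; rewrite leq_addr.
- by move=> n; case: (UP (n + L)%N (leq_addl _ _)).
- by move=> n; rewrite ler_pdivlMr // mulrC Ubd // leq_addl.
- move=> e e0; exists 0%N => n _ v Vv.
  by rewrite (UP _ (leq_addl _ _)).2 // subrr rnorm0 mulr_ge0 ?rnorm_ge0 // ltW.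
exists U' => // e e0.
pose C := (Ca + Ck) / gamma + 1.
have C0 : 0 < C by rewrite addr_gt0 // divr_gt0 // addr_gt0.
have [m [y Vy yU']] := (limit_spaceP V U').1 XU' (e / C) (divr_gt0 e0 C0).
exists (maxn m L) => l; rewrite geq_max => /andP[ml Ll].
have Vly : V l y by apply: V_nested Vy.
have qo : gamma * rnorm (U l - y) <= (Ca + Ck) * rnorm (U' - y).
  apply: (infsup_L l Ll).
  - by apply: finite_dimB => //; case: (UP l Ll).
  - by rewrite mulr_ge0 ?rnorm_ge0 // addr_ge0 // ltW.
  - move=> v Vv; rewrite sesquilinearBl // (UP l Ll).2 // -bU'.
      by rewrite -sesquilinearBl // perturbed_bounded.
    exact: limit_space_sub Vv.
rewrite -(subrKA y); apply: le_lt_trans (rnormD _ _) _; rewrite (rnorm_distC y).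
apply: le_lt_trans (_ : C * rnorm (U' - y) < _); last first.
  by rewrite mulrC -ltr_pdivlMr.
rewrite mulrDl mul1r lerD2r mulrAC ler_pdivlMr // mulrC.
exact: qo.
Qed.

(** If the normalized errors did not satisfy this, a subsequence [e] of them
    would have images under the compact operator converging in the dual norm to
    some functional [phi] that does not vanish on the limit space. Let [G]
    represent [- phi] there. Galerkin orthogonality says that [e] converges to
    [G] weakly with respect to [a]; as each functional [w |-> Kop w v] is itself
    represented through [a], weak convergence identifies [phi] with [Kop G].
    Hence [b G] vanishes on the limit space, so [G] and then [phi] vanish. *)
Lemma compact_part_of_error_small (u : H) (U : nat -> H) (L : nat) :
  Xinf u -> (forall l, (L <= l)%N -> V l (U l)) ->
  (forall l v, (L <= l)%N -> V l v -> b (u - U l) v = 0) ->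
  forall delta : R, 0 < delta -> exists N, forall l, (N <= l)%N -> forall v, Xinf v ->
    rnorm (Kop (u - U l) v) <= delta * rnorm (u - U l) * rnorm v.
Proof.
move=> Xu VU orth delta delta0; apply: contrapT => nsmall.
have {nsmall} bad (n : nat) : exists lv : nat * H, [/\ (maxn n L <= lv.1)%N, Xinf lv.2 &
    delta * rnorm (u - U lv.1) * rnorm lv.2 < rnorm (Kop (u - U lv.1) lv.2)].
  apply: contrapT => h; apply: nsmall; exists (maxn n L) => l nl v Xv.
  by rewrite leNgt; apply/negP => lt; apply: h; exists (l, v).
have [lv lvP] := choice bad.
pose l n := (lv n).1; pose d n := u - U (l n).
have nl n : (n <= l n)%N by case: (lvP n) => /(leq_trans (leq_maxl _ _)).
have Ll n : (L <= l n)%N by case: (lvP n) => /(leq_trans (leq_maxr _ _)).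
have d_neq0 n : d n != 0.
  apply/eqP => d0; have [_ _] := lvP n; rewrite -/(l n) -/(d n) d0 raddf0.
  by rewrite [X in _ < rnorm X](_ : _ = 0) // !rnorm0 mulr0 mul0r ltxx.
have dn_gt0 n : 0 < rnorm (d n) by rewrite rnorm_gt0.
pose e n := rscalar (rnorm (d n))^-1 *: d n.
have e1 n : rnorm (e n) = 1 by apply: rnorm_normalize.
have Xe n : Xinf (e n).
  apply: limit_spaceZ => //; apply: limit_spaceB => //.
  by apply: limit_space_sub (VU _ (Ll n)).
have be n v : V (l n) v -> b (e n) v = 0.
  by move=> Vv; rewrite sesquilinearZl ?orth ?mulr0 //; exact: perturbed_sesquilinear.
have Kev n : delta * rnorm (lv n).2 < rnorm (Kop (e n) (lv n).2).
  have [_ _] := lvP n; rewrite -/(l n) -/(d n) KopZ rnormMr gtr0_norm ?invr_gt0 //.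
  by move=> h; rewrite [ltRHS]mulrC ltr_pdivlMr // mulrAC.
have e_le1 n : rnorm (e n) <= 1 by rewrite e1.
have [s [phi [ns phiL [D D0 phiD] cvK]]] := compact_operator_subseq Kop_compact e_le1.
have riesz psi Dp (psiL : antilinear psi) (Dp0 : 0 <= Dp) (psiD : bounded_by Dp psi) :
    exists2 G, Xinf G & forall v, Xinf v -> a G v = psi v.
  have [_ [G [_ _ XG GP]]] := galerkin_riesz V_finite_dim V_nested alpha_gt0
    a_coercive Ca_gt0 a_bounded psiL Dp0 psiD.
  by exists G.
have [G XG GP] := riesz _ _ (antilinearN phiL) (ltW D0) (bounded_byN phiD).
have weak z : Xinf z -> forall eps : R, 0 < eps ->
    exists N, forall n, (N <= n)%N -> rnorm (a (e (s n) - G) z : K^o) < eps.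
  move=> Xz eps eps0.
  pose C := Ca * (1 + rnorm G).
  have C0 : 0 < C by rewrite mulr_gt0 // ltr_wpDr // rnorm_ge0.
  have [m [y Vy yz]] := (limit_spaceP V z).1 Xz (eps / 2 / C)
    (divr_gt0 (divr_gt0 eps0 (ltr0Sn _ _)) C0).
  have y1 : 0 < rnorm y + 1 by rewrite ltr_wpDl // rnorm_ge0.
  have [N hN] := cvK (eps / 2 / (rnorm y + 1))
    (divr_gt0 (divr_gt0 eps0 (ltr0Sn _ _)) y1).
  exists (maxn N m) => n; rewrite geq_max => /andP[Nn mn].
  have Vly : V (l (s n)) y.
    by apply: V_nested Vy; apply: leq_trans mn (leq_trans (ns n) (nl _)).
  have aey : a (e (s n) - G) y = - (Kop (e (s n)) y - phi y).
    rewrite linearBl /= GP; last exact: limit_space_sub Vy.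
    have := be _ _ Vly; rewrite /perturbed_form => /eqP; rewrite addr_eq0 => /eqP ->.
    by rewrite -[(- phi) y]/(- phi y) opprD.
  rewrite -[z](subrK y) linearDr /= [ltRHS]splitr; apply: le_lt_trans (rnormD _ _) _.
  apply: ltr_leD.
    apply: le_lt_trans (a_bounded _ _) _.
    apply: le_lt_trans (_ : C * rnorm (z - y) < _); last by rewrite mulrC -ltr_pdivlMr.
    rewrite ler_wpM2r ?rnorm_ge0 // ler_wpM2l ?(ltW Ca_gt0) //.
    by rewrite (le_trans (rnormB _ _)) // e1.
  rewrite aey rnormN; apply: le_trans (hN n Nn y) _.
  rewrite mulrAC ler_pdivrMr // ler_wpM2l ?lerDl //.
  by rewrite divr_ge0 // ltW.
(* For fixed [v] both sides are limits of [Kop (e (s n)) v]: the right-hand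
   one by the dual-norm convergence, the left-hand one by weak convergence
   tested with the representer [z] of [w |-> Kop w v]. *)
have KG v : Xinf v -> Kop G v = phi v.
  move=> Xv.
  pose psi w := sconj (Kop w v) : K^o.
  have psiL : antilinear psi.
    move=> c w w'; rewrite /psi (linearP Kop) /=.
    by rewrite -[(c *: Kop w + Kop w') v]/(c * Kop w v + Kop w' v) rmorphD rmorphM.
  have psiD : bounded_by (Ck * rnorm v) psi.
    by move=> w; rewrite /psi rnorm_conj mulrAC.
  have [z Xz zP] := riesz _ _ psiL (mulr_ge0 (ltW Ck_gt0) (rnorm_ge0 v)) psiD.
  have aK w : Xinf w -> a w z = Kop w v.
    by move=> Xw; rewrite hermitian_conj zP // /psi sconjK.
  apply/eqP; rewrite -subr_eq0; apply/eqP.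
  apply: (@rnorm_small_eq0 _ _ _ _ (1 + rnorm v)) => eps eps0.
  have [N1 hN1] := weak z Xz _ eps0; have [N2 hN2] := cvK _ eps0.
  pose n := maxn N1 N2.
  have h1 := hN1 n (leq_maxl _ _); have h2 := hN2 n (leq_maxr _ _) v.
  rewrite -[X in rnorm X](subrKA (Kop (e (s n)) v)); apply: le_trans (rnormD _ _) _.
  rewrite mulrDl mul1r [rnorm v * _]mulrC lerD //.
  by rewrite rnorm_distC -KopB -aK ?ltW //; apply: limit_spaceB.
have G0 : G = 0.
  apply: b_definite => // v Xv; rewrite /perturbed_form GP // KG //.
  by rewrite -[(- phi) v]/(- phi v) addNr.
have phi0 v : Xinf v -> phi v = 0.
  by move=> Xv; rewrite -KG // G0 raddf0.
have [N hN] := cvK _ delta0.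
have := Kev (s N); have [_ Xv _] := lvP (s N).
have := hN N (leqnn N) (lv (s N)).2.
rewrite -[X in rnorm X]/(Kop (e (s N)) (lv (s N)).2 - phi (lv (s N)).2) phi0 // subr0.
by move=> /le_lt_trans h /h; rewrite ltxx.
Qed.

End CompactPerturbation.

(** * Quasi-orthogonality, estimator reduction and contraction *)

Section QuasiOrthogonality.
Context {R : realType} {k : scalar_kind} {H : completeNormedModType (scalars R k)}.
Local Notation K := (scalars R k).
Variable a : {hermitian_sym H for sconj}.
Variable alpha : R.
Hypothesis alpha_gt0 : 0 < alpha.
Hypothesis a_coercive : forall v, alpha * rnorm v ^+ 2 <= sre (a v v).

Lemma energy_norm_sq v : energy_norm a v ^+ 2 = sre (a v v).
Proof.
rewrite sqr_sqrtr //; apply: le_trans (a_coercive v).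
by rewrite mulr_ge0 ?sqr_ge0 // ltW.
Qed.

(** The cross term in the Pythagoras identity is absorbed by Young's
    inequality. *)
Lemma quasi_pythagoras (x y : H) (eps : R) : 0 < eps < 1 ->
  rnorm (a x y : K^o) <= eps * alpha * rnorm x * rnorm y ->
  energy_norm a x ^+ 2 + energy_norm a y ^+ 2
    <= (1 - eps)^-1 * energy_norm a (x + y) ^+ 2.
Proof.
move=> /andP[eps0 eps1] axy; rewrite !energy_norm_sq energy_expand.
have e1 : 0 < 1 - eps by rewrite subr_gt0.
rewrite ler_pdivlMl //.
have cross : - sre (a x y) <= eps * alpha * rnorm x * rnorm y.
  by rewrite -sreN; apply: le_trans (sre_le_norm _) _; rewrite rnormN.
have young : 2 * (alpha * (rnorm x * rnorm y)) <= sre (a x x) + sre (a y y).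
  apply: le_trans (lerD (a_coercive x) (a_coercive y)).
  rewrite -mulrDr mulrCA ler_pM2l // -subr_ge0.
  by rewrite (_ : _ - _ = (rnorm x - rnorm y) ^+ 2) ?sqr_ge0 //; ring.
have := ler_wpM2l (ltW eps0) young; rewrite -!mulrA in cross *.
move: cross; rewrite !mulrA; lra.
Qed.
End QuasiOrthogonality.

Section RealSequences.
Context {R : realType}.
Implicit Types (q : R) (x d : nat -> R).

Lemma expr_lt_eventually q (e : R) : 0 <= q < 1 -> 0 < e ->
  exists N, forall n, (N <= n)%N -> q ^+ n < e.
Proof.
move=> /andP[q0 q1] e0.
have : (q ^+ n @[n --> \oo] --> (0 : R)) by apply: cvg_expr; rewrite ger0_norm.
move=> /cvgrPdist_lt /(_ e e0) [N _ hN]; exists N => n Nn.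
by have := hN n Nn; rewrite /= sub0r normrN; apply: le_lt_trans; rewrite ler_norm.
Qed.

(** Once [d] stays below [e / 2 * (1 - q)], the geometric series caps its total
    contribution at [e / 2], while the initial value is damped by powers of
    [q]. *)
Lemma perturbed_contraction_cvg0 x d q (L : nat) : 0 < q < 1 ->
  (forall n, (L <= n)%N -> x n.+1 <= q * x n + d n) ->
  (forall e, 0 < e -> exists N, forall n, (N <= n)%N -> d n < e) ->
  forall e, 0 < e -> exists N, forall n, (N <= n)%N -> x n < e.
Proof.
move=> /andP[q0 q1] xS d0 e e0.
have e2 : 0 < e / 2 * (1 - q) by rewrite mulr_gt0 ?divr_gt0 // subr_gt0.
have [N1 hN1] := d0 _ e2; pose N := maxn N1 L.
have step j : x (N + j)%N <= q ^+ j * x N + e / 2.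
  elim: j => [|j IH]; first by rewrite addn0 expr0 mul1r lerDl divr_ge0 // ltW.
  rewrite addnS; apply: le_trans (xS _ _) _.
    by rewrite (leq_trans (leq_maxr N1 L)) // leq_addr.
  have := hN1 (N + j)%N (leq_trans (leq_maxl N1 L) (leq_addr _ _)).
  by have := ler_wpM2l (ltW q0) IH; rewrite exprS mulrDr -mulrA; lra.
have x1 : 0 < `|x N| + 1 by rewrite ltr_wpDl.
have [||M hM] := @expr_lt_eventually q (e / 2 / (`|x N| + 1)).
- by rewrite ltW.
- by rewrite !divr_gt0.
exists (N + M)%N => n Nn; have Nn' : (N <= n)%N by apply: leq_trans Nn; rewrite leq_addr.
rewrite -(subnKC Nn'); apply: le_lt_trans (step _) _; rewrite [ltRHS]splitr ltrD2r.
apply: le_lt_trans (_ : q ^+ (n - N) * (`|x N| + 1) < _).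
  by rewrite ler_wpM2l ?exprn_ge0 ?(ltW q0) // (le_trans (ler_norm _)) // lerDl.
by rewrite -ltr_pdivlMr // hM // leq_subRL.
Qed.

(** The weighted sum [x + g * h] of squared error and squared estimator
    contracts. The increments [y] lost in the quasi-orthogonality pay for the
    perturbation in the estimator reduction; the factor [kappa > 1] in front of
    the error is compensated by shifting a little of the error, controlled by
    reliability, to the estimator, where [q < 1] leaves room for it. *)
Lemma combined_contraction (x y h : nat -> R) (kappa q g D : R) (l0 : nat) :
  0 < g -> 0 < D -> 1 <= kappa -> 0 < q < 1 -> (kappa - 1) * D < g * (1 - q) ->
  (forall l, 0 <= x l) -> (forall l, 0 <= h l) ->
  (forall l, (l0 <= l)%N -> x l.+1 + y l <= kappa * x l) ->
  (forall l, (l0 <= l)%N -> g * h l.+1 <= g * q * h l + y l) ->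
  (forall l, (l0 <= l)%N -> x l <= D * h l) ->
  exists2 rho : R, 0 < rho < 1 &
    forall l n, (l0 <= l)%N -> h (l + n)%N <= (D + g) / g * rho ^+ n * h l.
Proof.
move=> g0 D0 k1 /andP[q0 q1] small x0 h0 orth red rel.
have Dg : 0 < D + g by rewrite addr_gt0.
(* The rate at which the remaining inequality is an equality when
   [x l = D * h l]. *)
pose rho := (kappa * D + g * q) / (D + g).
have rho0 : 0 < rho.
  by rewrite divr_gt0 // addr_gt0 ?mulr_gt0 // (lt_le_trans ltr01).
have rho1 : rho < 1 by rewrite ltr_pdivrMr // mul1r; move: small; lra.
have rhoE : rho * (D + g) = kappa * D + g * q by rewrite divfK // gt_eqF.
exists rho; first by rewrite rho0.
move=> l n ll0.
have step m : x (l + m)%N + g * h (l + m)%N <= rho ^+ m * (x l + g * h l).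
  elim: m => [|m IH]; first by rewrite addn0 expr0 mul1r.
  have lm : (l0 <= l + m)%N by rewrite (leq_trans ll0) // leq_addr.
  rewrite addnS exprS -mulrA.
  apply: le_trans (ler_wpM2l (ltW rho0) IH).
  have k_rho : 0 <= kappa - rho by rewrite subr_ge0 (le_trans (ltW rho1)).
  have := ler_wpM2l k_rho (rel _ lm).
  have := orth _ lm; have := red _ lm.
  have : rho * (D + g) * h (l + m)%N = (kappa * D + g * q) * h (l + m)%N.
    by rewrite rhoE.
  by move: (x _) (x _) (y _) (h _) (h _) => t1 t2 t3 t4 t5; nra.
rewrite -(ler_pM2l g0); apply: le_trans (_ : x (l + n)%N + g * h (l + n)%N <= _).
  by rewrite lerDr.
apply: le_trans (step n) _.
rewrite [leRHS](_ : _ = rho ^+ n * ((D + g) * h l)); last by field; rewrite gt_eqF.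
by rewrite ler_wpM2l ?exprn_ge0 ?(ltW rho0) // mulrDl lerD2r rel.
Qed.
End RealSequences.

Section EstimatorReduction.
Context {R : realType} {d : nat}.
Variable eta : mesh R d -> simplex R d -> R.
Implicit Types (T M A B : mesh R d).

Lemma estimator_ge0 T M : 0 <= estimator eta T M.
Proof. exact: sqrtr_ge0. Qed.

Lemma estimator_sq T M : estimator eta T M ^+ 2 = \sum_(S <- M) eta T S ^+ 2.
Proof. by rewrite sqr_sqrtr // sumr_ge0 // => S _; rewrite sqr_ge0. Qed.

Lemma estimator_sq_split T A B : estimator eta T A ^+ 2 =
  estimator eta T (A `&` B)%fset ^+ 2 + estimator eta T (A `\` B)%fset ^+ 2.
Proof.
rewrite !estimator_sq (big_fsetID _ (mem B)) /=; congr (_ + _).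
  by apply: eq_fbigl => S; rewrite !inE.
by apply: eq_fbigl => S; rewrite !inE andbC.
Qed.

Lemma estimator_sq_mono T A B : (A `<=` B)%fset ->
  estimator eta T A ^+ 2 <= estimator eta T B ^+ 2.
Proof.
by move=> /fsetIidPr AB; rewrite (estimator_sq_split T B A) AB lerDl sqr_ge0.
Qed.

(** Marked elements are refined, so Doerfler marking puts at least the fraction
    [theta] of the squared estimator on refined elements, where it is reduced by
    [qred]. With [delta] half of the resulting gain [theta * (1 - qred)], the
    factor [1 + delta] that Young's inequality costs on the other elements still
    leaves the total below one. *)
Lemma doerfler_estimator_reduction (theta Cstb Cred qred : R) :
  0 < theta <= 1 -> 0 < qred < 1 -> 0 < Cstb ->
  exists q C : R, [/\ 0 < q < 1, 0 < C & forall T T' M (n : R), 0 <= n ->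
    doerfler eta theta T M -> (M `<=` T `\` T')%fset ->
    `| estimator eta T' (T' `&` T)%fset - estimator eta T (T' `&` T)%fset | <= Cstb * n ->
    estimator eta T' (T' `\` T)%fset ^+ 2
      <= qred * estimator eta T (T `\` T')%fset ^+ 2 + Cred ^+ 2 * n ^+ 2 ->
    estimator eta T' T' ^+ 2 <= q * estimator eta T T ^+ 2 + C * n ^+ 2].
Proof.
move=> /andP[th0 th1] /andP[qr0 qr1] Cs0.
pose delta := theta * (1 - qred) / 2.
have delta0 : 0 < delta by rewrite divr_gt0 // mulr_gt0 // subr_gt0.
have delta1 : delta < 1.
  rewrite ltr_pdivrMr // mul1r; apply: le_lt_trans (_ : 1 < _); last by lra.
  by apply: mulr_ile1; lra.
exists (1 - delta), ((1 + delta^-1) * Cstb ^+ 2 + Cred ^+ 2); split.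
- by apply/andP; split; lra.
- rewrite ltr_wpDr ?sqr_ge0 // mulr_gt0 ?exprn_gt0 // addr_gt0 // invr_gt0 //.
move=> T T' M n n0 [MT mark] MTT' stab red.
have stab2 : estimator eta T' (T' `&` T)%fset ^+ 2 <=
    (1 + delta) * estimator eta T (T' `&` T)%fset ^+ 2
      + (1 + delta^-1) * (Cstb ^+ 2 * n ^+ 2).
  move: stab (estimator_ge0 T' (T' `&` T)%fset) (estimator_ge0 T (T' `&` T)%fset).
  move: (estimator _ _ _) (estimator _ _ _) => r p /ler_normlP[_ pr] p0 r0.
  have {}pr : p <= r + Cstb * n by lra.
  have sq : p ^+ 2 <= (r + Cstb * n) ^+ 2.
    by rewrite ler_pXn2r ?nnegrE // addr_ge0 // mulr_ge0 // ltW.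
  apply: le_trans sq _; rewrite -subr_ge0 -exprMn.
  rewrite (_ : _ - _ = delta^-1 * (delta * r - Cstb * n) ^+ 2).
    by rewrite mulr_ge0 ?sqr_ge0 // invr_ge0 ltW.
  by field; rewrite gt_eqF.
have split' := estimator_sq_split T' T' T.
have splitT := estimator_sq_split T T T'.
rewrite [(T `&` T')%fset]fsetIC in splitT.
have marked := le_trans mark (estimator_sq_mono T MTT').
have {}marked : 2 * delta * (estimator eta T (T' `&` T)%fset ^+ 2
    + estimator eta T (T `\` T')%fset ^+ 2)
    <= (1 - qred) * estimator eta T (T `\` T')%fset ^+ 2.
  rewrite -splitT (_ : 2 * delta = (1 - qred) * theta) -?mulrA.
    by rewrite ler_wpM2l // subr_ge0 ltW.
  by rewrite /delta; field.
rewrite split' splitT.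
have lost := mulr_ge0 (ltW delta0) (sqr_ge0 (estimator eta T (T `\` T')%fset)).
by move: stab2 red marked lost; lra.
Qed.
End EstimatorReduction.

(** * The meshes of the adaptive algorithm and linear convergence *)

Section AdaptiveMeshes.
Context {R : realType} {k : scalar_kind} {H : completeNormedModType (scalars R k)}.
Context {d : nat}.
Variables (b : H -> H -> scalars R k) (f : H -> (scalars R k)^o).
Variables (Omega : set 'rV[R]_d) (adm : mesh R d -> mesh R d -> Prop).
Variables (T0 : mesh R d) (refine : mesh R d -> mesh R d -> mesh R d).
Variables (X : mesh R d -> set H) (eta : mesh R d -> simplex R d -> R).
Variables (theta Cmark : R) (T : nat -> mesh R d) (U : nat -> H) (etas : nat -> R).
Hypothesis T0_conforming : conforming Omega T0.
Hypothesis refine_strategy : refinement_strategy Omega adm refine.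
Hypothesis output : adaptive_output b f T0 refine X eta theta Cmark T U etas.

Lemma adaptive_step l : exists2 M, (M `<=` T l)%fset & T l.+1 = refine (T l) M.
Proof.
have [noU hasU] := output.2 l.
have [ex|nex] := pselect (solution_exists b f X (T l)).
  by have [M [[MT _] _] [_ _ TE]] := hasU ex; exists M.
by have [_ _ TE] := noU nex; exists (T l).
Qed.

(** The refinement strategy is specified on conforming meshes only, so
    conformity has to be carried along the algorithm. *)
Lemma adaptive_conforming l : conforming Omega (T l).
Proof.
elim: l => [|l IH]; first by rewrite output.1.
have [M MT ->] := adaptive_step l.
by have [[]] := refine_strategy IH MT.
Qed.

Lemma adaptive_refinement l m : (l <= m)%N -> refinement refine (T l) (T m).
Proof.
elim: m => [|m IH]; first by rewrite leqn0 => /eqP ->; left.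
rewrite leq_eqVlt => /predU1P[->|]; first by left.
rewrite ltnS => /IH lm; have [M MT ->] := adaptive_step m; exact: refinementS.
Qed.

Lemma adaptive_refinement0 l : refinement refine T0 (T l).
Proof. by rewrite -output.1; apply: adaptive_refinement. Qed.

Lemma adaptive_solution l : solution_exists b f X (T l) ->
  [/\ is_solution b f X (T l) (U l), etas l = estimator eta (T l) (T l) &
      exists2 M, doerfler eta theta (T l) M & (M `<=` T l `\` T l.+1)%fset].
Proof.
move=> ex; have [M [[MT mark] _] [Usol etaE TE]] := (output.2 l).2 ex.
split=> //; exists M => //; rewrite TE.
by have [[]] := refine_strategy (adaptive_conforming l) MT.
Qed.
End AdaptiveMeshes.

Theorem theorem19
    (R : realType) (k : scalar_kind)
    (H : completeNormedModType (scalars R k))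
    (ip : {dot H for sconj}) (ip_norm : induces_norm ip)
    (H_separable : separable H)
    (a : {hermitian_sym H for sconj})
    (a_continuous : continuous (fun z : H * H => a z.1 z.2 : (scalars R k)^o))
    (a_elliptic : elliptic a)
    (Kop : {linear H -> (H -> (scalars R k)^o)})
    (Kop_compact : compact_operator Kop)
    (f : H -> (scalars R k)^o) (f_dual : dual_space f)
    (b := perturbed_form a Kop)
    (well_posed : forall w : H, w = 0 <-> forall v, b w v = 0)
    (u : H) (u_solution : forall v, b u v = f v)
    (d : nat) (d_ge2 : (2 <= d)%N)
    (Omega : set 'rV[R]_d)
    (Omega_lipschitz : lipschitz_domain Omega)
    (Omega_polyhedral : polyhedral Omega)
    (T0 : mesh R d) (T0_conforming : conforming Omega T0)
    (adm : mesh R d -> mesh R d -> Prop)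
    (refine : mesh R d -> mesh R d -> mesh R d)
    (refine_strategy : refinement_strategy Omega adm refine)
    (refine_meshsize : meshsize_reduction refine T0)
    (X : mesh R d -> set H)
    (X_spaces : discrete_spaces T0 refine X)
    (X_dense : dense_under_uniform_refinement T0 refine X)
    (eta : mesh R d -> simplex R d -> R)
    (eta_ge0 : nonneg_indicators b f T0 refine X eta)
    (theta Cmark : R) (theta_bounds : 0 < theta <= 1) (Cmark_ge1 : 1 <= Cmark)
    (T : nat -> mesh R d) (U : nat -> H) (etas : nat -> R)
    (output : adaptive_output b f T0 refine X eta theta Cmark T U etas)
    (eta_stability : stability b f T0 refine X eta)
    (eta_reduction : reduction b f T0 refine X eta)
    (eta_reliability : reliability b f T0 refine X eta u)
    (eta_discrete_reliability : discrete_reliability b f T0 refine X eta)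
    (b_definite : definite_on b (closure (\bigcup_l X (T l)))) :
  exists eps : R, 0 < eps < 1 /\
  exists l3 : nat,
    (forall l, (l3 <= l)%N ->
       energy_norm a (u - U l.+1) ^+ 2 + energy_norm a (U l.+1 - U l) ^+ 2
         <= (1 - eps)^-1 * energy_norm a (u - U l) ^+ 2) /\
    exists qlin Clin : R,
      [/\ 0 < qlin < 1, 0 < Clin &
          forall l n, (l3 <= l)%N -> etas (l + n)%N <= Clin * qlin ^+ n * etas l].
Proof.
have [alpha alpha0 a_coercive] := a_elliptic.
have [Ca Ca0 a_bounded] := continuous_form_bounded a_continuous.
have [Ck Ck0 Kop_bounded] := compact_operator_bounded Kop_compact.
have [f_antilinear [Df Df0 f_bounded]] := dual_space_bounded f_dual.
have [Cstb Cstb0 stab] := eta_stability.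
have [Cred [qred [Cred0 qred01 red]]] := eta_reduction.
have [Crel Crel0 rel] := eta_reliability.
have refine0 := adaptive_refinement0 output.
have refineS l : refinement refine (T l) (T l.+1) by apply: (adaptive_refinement output).
have V_fin l : finite_dim_subspace (X (T l)) by apply: X_spaces.1.
have V_nested l m : (l <= m)%N -> X (T l) `<=` X (T m).
  by move=> lm; apply: X_spaces.2 => //; apply: (adaptive_refinement output lm).
have [L [exU convU]] := discrete_solutions_converge V_fin V_nested alpha0 a_coercive
  Ca0 a_bounded Kop_compact Ck0 Kop_bounded b_definite f_antilinear (ltW Df0) f_bounded.
have sol l (Ll : (L <= l)%N) := adaptive_solution T0_conforming refine_strategy output (exU l Ll).
have Usol l : (L <= l)%N -> is_solution b f X (T l) (U l) by case/sol.
have etaE l : (L <= l)%N -> etas l = estimator eta (T l) (T l) by case/sol.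
have [q [C [q01 C0 estred]]] := doerfler_estimator_reduction eta Cred theta_bounds qred01 Cstb0.
have reduction_step l : (L <= l)%N ->
    etas l.+1 ^+ 2 <= q * etas l ^+ 2 + C * rnorm (U l.+1 - U l) ^+ 2.
  move=> Ll; have LlS := leqW Ll; have [_ _ [M mark MT]] := sol l Ll.
  rewrite !etaE //; apply: estred mark MT _ _; first exact: rnorm_ge0.
    by apply: stab => //; apply: Usol.
  by apply: red => //; apply: Usol.
have galU l : (L <= l)%N -> galerkin b f (X (T l)) (U l) by move=> /Usol[].
have [U' XU' UU'] := convU U galU.
have eta_cvg0 : forall e : R, 0 < e -> exists N, forall n, (N <= n)%N -> etas n ^+ 2 < e.
  apply: (perturbed_contraction_cvg0 (L := L) q01 reduction_step) => e e0.
  pose r := Num.sqrt (e / C) / 2.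
  have sq0 : 0 < Num.sqrt (e / C) by rewrite sqrtr_gt0 divr_gt0.
  have r0 : 0 < r by rewrite divr_gt0.
  have [N hN] := UU' r r0; exists N => n Nn.
  have n1 := hN n Nn; have n2 := hN n.+1 (leqW Nn).
  have : rnorm (U n.+1 - U n) < Num.sqrt (e / C).
    rewrite -(subrKA U'); apply: le_lt_trans (rnormD _ _) _.
    by rewrite (rnorm_distC U') [ltRHS]splitr ltrD.
  rewrite -(ltr_pXn2r (ltn0Sn 1)) ?nnegrE ?rnorm_ge0 ?(ltW sq0) //.
  rewrite sqr_sqrtr ?divr_ge0 ?(ltW e0) ?(ltW C0) //.
  by rewrite ltr_pdivlMr // mulrC.
have rel_l l : (L <= l)%N -> rnorm (u - U l) <= Crel * etas l.
  by move=> Ll; rewrite etaE //; apply: rel => //; apply: Usol.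
have uU' : u = U'.
  apply/eqP; rewrite -subr_eq0; apply/eqP.
  apply: (@rnorm_small_eq0 _ _ _ _ (Crel + 1)) => e e0.
  have [N1 hN1] := UU' e e0; have [N2 hN2] := eta_cvg0 _ (exprn_gt0 2 e0).
  pose l := maxn L (maxn N1 N2).
  have Ll : (L <= l)%N by rewrite leq_maxl.
  have N1l : (N1 <= l)%N by rewrite !leq_max leqnn orbT.
  have N2l : (N2 <= l)%N by rewrite !leq_max leqnn !orbT.
  rewrite -(subrKA (U l)); apply: le_trans (rnormD _ _) _.
  rewrite mulrDl mul1r lerD ?(ltW (hN1 l N1l)) //.
  apply: le_trans (rel_l l Ll) _; rewrite ler_wpM2l ?(ltW Crel0) //.
  rewrite -(ler_pXn2r (ltn0Sn 1)) ?nnegrE ?(ltW e0) ?(ltW (hN2 l N2l)) //.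
  by rewrite etaE // estimator_ge0.
have Xu : closure (\bigcup_l X (T l)) u by rewrite uU'.
(* Multiplied by this weight, the term [C * rnorm (U l.+1 - U l) ^+ 2] of the
   estimator reduction is at most the squared energy norm of the increment. *)
pose g := alpha / C; pose D := Ca * Crel ^+ 2; pose t := g * (1 - q) / (2 * D).
have [q0 q1] := andP q01.
have g0 : 0 < g by rewrite divr_gt0.
have D0 : 0 < D by rewrite mulr_gt0 // exprn_gt0.
have t0 : 0 < t by apply: divr_gt0; apply: mulr_gt0; rewrite ?subr_gt0.
have t1 : 0 < 1 + t by rewrite addr_gt0.
(* The quasi-orthogonality then has the factor [1 + t], with [t] half of the
   largest value that the contraction admits. *)
pose eps := t / (1 + t).
have eps0 : 0 < eps by rewrite divr_gt0.
have eps01 : 0 < eps < 1 by rewrite eps0 /= ltr_pdivrMr // mul1r ltrDr ltr01.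
have kappaE : (1 - eps)^-1 = 1 + t.
  rewrite -[RHS]invrK; congr (_^-1); rewrite /eps; field.
  by rewrite gt_eqF.
have orthU l v : (L <= l)%N -> X (T l) v -> b (u - U l) v = 0.
  move=> Ll Vv; have bS := perturbed_sesquilinear a Kop_compact.
  by rewrite /b sesquilinearBl // -/b u_solution (galU l Ll).2 // subrr.
have XU l : (L <= l)%N -> X (T l) (U l) by case/galU.
have [N small] := compact_part_of_error_small V_fin V_nested alpha0 a_coercive
  Ca0 a_bounded Kop_compact Ck0 Kop_bounded b_definite Xu XU orthU
  (mulr_gt0 eps0 alpha0).
exists eps; split => //; exists (maxn N L).
have quasi_orthogonality l : (maxn N L <= l)%N ->
    energy_norm a (u - U l.+1) ^+ 2 + energy_norm a (U l.+1 - U l) ^+ 2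
      <= (1 - eps)^-1 * energy_norm a (u - U l) ^+ 2.
  rewrite geq_max => /andP[Nl Ll].
  have VU : X (T l.+1) (U l.+1 - U l).
    apply: finite_dimB => //; first exact: XU _ (leqW Ll).
    by apply: V_nested (leqnSn l) _ _; apply: XU.
  rewrite -(subrKA (U l.+1) u (- U l)); apply: (quasi_pythagoras alpha0 a_coercive eps01).
  have : b (u - U l.+1) (U l.+1 - U l) = 0 by apply: orthU => //; exact: leqW.
  rewrite /b /perturbed_form => /eqP; rewrite addr_eq0 => /eqP ->; rewrite rnormN.
  apply: small (leqW Nl) _ _.
  by apply: (limit_space_sub (V := fun l => X (T l))) VU.
split=> //.
have [||||||||||rho /andP[rho0 rho1] decay] := @combined_contraction R
  (fun l => energy_norm a (u - U l) ^+ 2) (fun l => energy_norm a (U l.+1 - U l) ^+ 2)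
  (fun l => etas l ^+ 2) (1 + t) q g D (maxn N L).
- exact: g0.
- exact: D0.
- by rewrite lerDl ltW.
- exact: q01.
- have -> : (1 + t - 1) * D = g * (1 - q) / 2 by rewrite /t; field; rewrite gt_eqF.
  by rewrite ltr_pdivrMr // ltr_pMr ?ltr1n // mulr_gt0 // subr_gt0.
- by move=> l; rewrite sqr_ge0.
- by move=> l; rewrite sqr_ge0.
- by move=> l; rewrite -kappaE; exact: quasi_orthogonality.
- move=> l; rewrite geq_max => /andP[_ Ll].
  apply: le_trans (ler_wpM2l (ltW g0) (reduction_step l Ll)) _.
  rewrite mulrDr mulrA lerD2l mulrA divfK ?gt_eqF //.
  by rewrite (energy_norm_sq alpha0 a_coercive).
- move=> l; rewrite geq_max => /andP[_ Ll].
  rewrite (energy_norm_sq alpha0 a_coercive); apply: le_trans (sre_le_norm _) _.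
  apply: le_trans (a_bounded _ _) _; rewrite -!mulrA ler_wpM2l ?(ltW Ca0) //.
  by rewrite /= mulrA -!expr2 -exprMn lerXn2r ?nnegrE ?rnorm_ge0 ?(le_trans (rnorm_ge0 _) (rel_l l Ll)) ?rel_l.
exists (Num.sqrt rho), (Num.sqrt ((D + g) / g)); split.
- rewrite sqrtr_gt0 rho0 /= -(ltr_pXn2r (ltn0Sn 1)) ?nnegrE ?sqrtr_ge0 //.
  by rewrite expr1n sqr_sqrtr // ltW.
- by rewrite sqrtr_gt0 divr_gt0 // addr_gt0.
move=> l n l3; have /andP[_ Ll] : (N <= l)%N && (L <= l)%N by rewrite -geq_max.
have eta0 m : 0 <= etas (l + m)%N.
  by rewrite etaE ?estimator_ge0 // (leq_trans Ll) // leq_addr.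
have eta0l := eta0 0%N; rewrite addn0 in eta0l.
rewrite -(ler_pXn2r (ltn0Sn 1)) ?nnegrE ?mulr_ge0 ?exprn_ge0 ?sqrtr_ge0 //.
have Dg0 : 0 < (D + g) / g by rewrite divr_gt0 // addr_gt0.
rewrite !exprMn exprAC !sqr_sqrtr ?(ltW rho0) ?(ltW Dg0) //.
exact: decay.
Qed.
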